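(* Let $q$ be a sufficiently large prime. Let $\mathcal{A}\subseteq\mathcal{X}_q$ be a set of multiplicative characters of cardinality $A=\#\mathcal{A}$ satisfying $\#(\mathcal{A}\cdot\mathcal{A})\le KA$ for some $K\ge1$. Then, for a positive integer $N\le q$ and complex coefficients $\boldsymbol{\alpha}=(\alpha_n)_{n=1}^N$ with $|\alpha_n|\le1$ for $1\le n\le N$, we have $$M(\boldsymbol{\alpha},\mathcal{A},N)\le K^{1/2}\left(N^{1/2}+A^{-1/2}N+A^{-3/8}N^{1/2}q^{1/4}\right)q^{o(1)},$$ where $o(1)$ denotes a quantity tending to $0$ as $q\to\infty$.
   Context: $\mathcal{X}_q$ is the group of multiplicative (Dirichlet) characters modulo $q$. The product set is $\mathcal{A}\cdot\mathcal{A}=\{\chi_1\cdot\chi_2:\ \chi_1,\chi_2\in\mathcal{A}\}$. The mean value is $$M(\boldsymbol{\alpha},\mathcal{A},N)=\frac1A\sum_{\chi\in\mathcal{A}}\left|\sum_{n=1}^N\alpha_n\chi(n)\right|,\qquad A=\#\mathcal{A}.$$ *)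

(* Defs.v *)
From HB Require Import structures.
From mathcomp Require Import all_boot all_order all_algebra.
From mathcomp Require Import finmap complex.
From mathcomp Require Import all_classical all_reals all_analysis.
Set Implicit Arguments.
Unset Strict Implicit.
Unset Printing Implicit Defensive.
Import Order.TTheory GRing.Theory Num.Theory.
Import numFieldNormedType.Exports.

Local Open Scope ring_scope.
Local Open Scope complex_scope.

(* The library's modulus [`|z|] on [R[i]] is itself an element of [R[i]];
   [ComplexField.Normc.normc z] is the same quantity as an element of [R]. *)
Definition cabs (R : realType) (z : R[i]) : R := ComplexField.Normc.normc z.

(* A character modulo [q] is a function on the residue ring ['Z_q], extended
   by zero to the non-units. ['Z_q] is the ring of integers modulo [q] only
   when [1 < q]. *)
Definition dirichlet_character (R : realType) (q : nat)
    (chi : {ffun 'Z_q -> R[i]}) : Prop :=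
  [/\ chi 1 = 1,
      forall x y : 'Z_q, chi (x * y) = chi x * chi y
    & forall x : 'Z_q, x \isn't a GRing.unit -> chi x = 0].

Definition charM (R : realType) (q : nat) (chi1 chi2 : {ffun 'Z_q -> R[i]}) :
    {ffun 'Z_q -> R[i]} :=
  [ffun x => chi1 x * chi2 x].

Definition product_set (R : realType) (q : nat)
    (A : {fset {ffun 'Z_q -> R[i]}}) : {fset {ffun 'Z_q -> R[i]}} :=
  [fset charM chi1 chi2 | chi1 in A, chi2 in A]%fset.

(* Only the values [alpha n] with [1 <= n <= N] matter. For [A] empty the
   conventions [0^-1 = 0] and empty sum [= 0] give the value [0]. *)
Definition mean_value (R : realType) (q : nat) (alpha : nat -> R[i])
    (A : {fset {ffun 'Z_q -> R[i]}}) (N : nat) : R :=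
  (#|` A|)%:R^-1 *
  \sum_(chi <- A) cabs (\sum_(1 <= n < N.+1) alpha n * chi n%:R).

(* Main.v *)
Require Import Defs.
From mathcomp Require Import all_boot all_order all_algebra.
From mathcomp Require Import fingroup finmap complex ring lra zify.
From mathcomp Require Import all_classical all_reals all_analysis.
Import Order.TTheory GRing.Theory Num.Theory.
Import numFieldNormedType.Exports.
Set Implicit Arguments.
Unset Strict Implicit.
Unset Printing Implicit Defensive.
Local Open Scope classical_set_scope.
Local Open Scope ring_scope.

(** Write A for the set of characters and for its cardinality.  The
    characters of A are studied through their correlations
    T(m,n) = sum over chi in A of chi(m) conj(chi(n)), and the quantity to
    bound is the energy E_A(N), the sum of |T(m,n)|^2 over m, n <= N.
    Expanding the squares the other way, E_A(N) is also the sum over psi, chi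
    in A of |sum_{n <= N} psi conj(chi)(n)|^2 ([energyE]).  The first form is a
    sum of nonnegative terms, so it can be enlarged, weighted and reindexed at
    will; the second one sees the multiplicative structure.

    Reduction to the energy ([large_values]).  Let S(chi) be the inner sum of
    the mean value.  As chi = (chi phi) conj(phi) for every phi in A, the sum
    of |S(chi)|^2 over A, multiplied by #A, is at most the sum of
    |S(psi conj(phi))|^2 over psi in A.A and phi in A.  Expanding this sum and
    applying Cauchy-Schwarz over the pairs (m,n) bounds it by the geometric
    mean of E_A(N) and E_{A.A}(N).  Taking this mean, instead of bounding
    everything by the energy of A.A, is what produces the factor K^(1/2).

    Heath-Brown's bound ([energy_bound]) states that E_A(N)/N is at most
    G(N) = A N + A^2 + A^(5/4) q^(1/2), up to a power of D, where D bounds the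
    number of divisors of the integers up to q.  It follows from three
    inequalities.
    - Dilation ([energy_dilate]): T(pm,pn) = T(m,n), so E_A(N)/N is essentially
      nondecreasing in N.
    - Squaring ([energy_holder]): the square of a character sum of length L is
      a character sum of length L^2 with coefficients at most D, and
      Cauchy-Schwarz gives E_A(L) <= A D E_A(L^2)^(1/2).
    - Reflection ([energy_reflect]): Gauss sums exchange the lengths N and
      L = q/(8N), giving E_A(N) << A N^2 + (N^2/q) E_A(L).  The interval is
      majorized by a Fejer kernel; its Fourier transform has compact support,
      so the dual sum stops exactly at L and leaves no tail.

    Let phi be the best constant in E_A(M) <= phi M G(M) for M <= q.  Given M,
    pass by dilation to a length M1 at least q^(1/2) A^(1/4), cut at q,
    reflect to L = q/(8 M1), square, and use the definition of phi at L^2.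
    The exponents are such that this yields phi << D^2 (1 + phi^(1/2)), hence
    phi << D^4.  Finally D = q^o(1) by the divisor bound
    ([num_divisors_bound]), which is where the factor q^o(1) comes from. *)

(** * The divisor bound *)

Section DivisorBound.
Local Open Scope nat_scope.

Definition num_divisors n := size (divisors n).

(** A divisor d of a b is recovered from gcd(d,a) and gcd(d,b) as their
    product. *)
Lemma num_divisorsM_le a b : 0 < a -> 0 < b -> coprime a b ->
  num_divisors (a * b) <= num_divisors a * num_divisors b.
Proof.
move=> a_gt0 b_gt0 co_ab; have ab_gt0 : 0 < a * b by rewrite muln_gt0 a_gt0.
rewrite /num_divisors -(size_allpairs pair).
apply: (@leq_trans (size [seq (gcdn d a, gcdn d b) | d <- divisors (a * b)])).
  by rewrite size_map.
apply: uniq_leq_size.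
  rewrite map_inj_in_uniq ?divisors_uniq // => d e.
  rewrite -!dvdn_divisors // => dab eab [ea eb].
  have H c : c %| a * b -> c = gcdn c a * gcdn c b.
    move=> cab; apply/eqP; rewrite eqn_dvd Gauss_dvd; last first.
      by rewrite (coprime_dvdl (dvdn_gcdr _ _)) // (coprime_dvdr (dvdn_gcdr _ _)).
    rewrite !dvdn_gcdl !andbT muln_gcdr !muln_gcdl !dvdn_gcd cab.
    by rewrite (@dvdn_mulr c c c) // (@dvdn_mull c a c) // (@dvdn_mulr c c b).
  by rewrite (H d) // (H e) // ea eb.
move=> _ /mapP[d _ ->]; apply/allpairsP; exists (gcdn d a, gcdn d b).
by rewrite -!dvdn_divisors // !dvdn_gcdr.
Qed.

Lemma num_divisorsX p e : prime p -> num_divisors (p ^ e) = e.+1.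
Proof.
move=> p_pr; rewrite /num_divisors.
have/perm_size -> : perm_eq (divisors (p ^ e)) [seq p ^ i | i <- iota 0 e.+1].
  apply: uniq_perm; rewrite ?divisors_uniq ?map_inj_uniq ?iota_uniq //.
    exact: (expnI (prime_gt1 p_pr)).
  move=> d; rewrite -dvdn_divisors ?expn_gt0 ?prime_gt0 //.
  apply/(dvdn_pfactor _ _ p_pr)/mapP => -[j].
    by move=> le_je ->; exists j; rewrite ?mem_iota.
  by rewrite mem_iota => /= le_je ->; exists j.
by rewrite size_map size_iota.
Qed.

(** If e = k f + r with r < k, then e + 1 <= k (f + 1) <= k 2^f, and
    2^(k f) <= 2^e. *)
Lemma expS_le_pow2 k e : 0 < k -> e.+1 ^ k <= k ^ k * 2 ^ e.
Proof.
move=> k_gt0; rewrite {1}(divn_eq e k).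
apply: (@leq_trans ((k * 2 ^ (e %/ k)) ^ k)).
  rewrite leq_exp2r //; apply: (@leq_trans (k * (e %/ k).+1)).
    by rewrite mulnS addnC mulnC -addSn leq_add2r ltn_mod.
  by rewrite leq_mul2l ltn_expl ?orbT.
rewrite expnMn leq_mul2l -expnM leq_exp2l // leq_trunc_div orbT //.
Qed.

(** The number of divisors is n^o(1).  A prime p >= 2^k with exponent e
    contributes (e + 1)^k <= 2^(k e) <= p^e, which is free; each of the fewer
    than 2^k smaller primes costs the constant k^k of [expS_le_pow2]. *)
Lemma num_divisors_bound k n : 0 < k -> 0 < n ->
  num_divisors n ^ k <= (k ^ k) ^ (2 ^ k) * n.
Proof.
move=> k_gt0 n_gt0.
have kk_gt0 : 0 < k ^ k by rewrite expn_gt0 k_gt0.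
suff H m : 0 < m ->
    num_divisors m ^ k <= (k ^ k) ^ (count [pred p | p < 2 ^ k] (primes m)) * m.
  apply: leq_trans (H _ n_gt0) _; rewrite leq_mul2r leq_pexp2l ?orbT //.
  rewrite -size_filter -[leqRHS](size_iota 0); apply: uniq_leq_size.
    by rewrite filter_uniq ?primes_uniq.
  by move=> p; rewrite mem_filter mem_iota => /andP[].
(* Strip from m the full power of its least prime factor. *)
elim/ltn_ind: m => -[//|[|m]] IHm _; first by rewrite exp1n.
set N := m.+2; have N_gt1 : 1 < N by [].
pose p := pdiv N; have p_pr : prime p by rewrite pdiv_prime.
have [u co_pu defN] := pfactor_coprime p_pr (isT : 0 < N).
have e_gt0 : 0 < logn p N by rewrite logn_gt0 pi_pdiv.
move: (logn p N) e_gt0 defN => e e_gt0 defN.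
have u_gt0 : 0 < u by case: (u) defN => // ->; rewrite mul0n.
have ltuN : u < N by rewrite defN ltn_Pmulr // -(expn0 p) ltn_exp2l ?prime_gt1.
have /(_ ltuN u_gt0) IHu := IHm u.
have co_up : coprime u (p ^ e) by rewrite coprime_sym coprimeXl.
have primesN : perm_eq (primes N) (p :: primes u).
  apply: uniq_perm; rewrite /= ?primes_uniq //.
    by rewrite mem_primes p_pr u_gt0 -prime_coprime // co_pu.
  have pe_gt0 : 0 < p ^ e by rewrite expn_gt0 prime_gt0.
  move=> r; rewrite defN primesM // inE orbC.
  by rewrite primesX // primes_prime // mem_seq1.
rewrite (permP primesN) /= {1}defN expnD.
apply: (@leq_trans ((num_divisors u * e.+1) ^ k)).
  rewrite leq_exp2r // -(num_divisorsX e p_pr) num_divisorsM_le //.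
  by rewrite expn_gt0 prime_gt0.
rewrite expnMn defN [X in _ <= X * _]mulnC mulnACA leq_mul //.
case: ltnP => [_|le2p] /=.
  rewrite expn1 (leq_trans (expS_le_pow2 _ k_gt0)) // leq_mul2l.
  by rewrite leq_exp2r ?prime_gt1 ?orbT.
rewrite expn0 mul1n; apply: (@leq_trans ((2 ^ k) ^ e)); last by rewrite leq_exp2r.
by rewrite -expnM mulnC expnM leq_exp2r // ltn_expl.
Qed.

End DivisorBound.

(** * Sums, duality and the energy *)

Section ComplexModulus.
Local Open Scope complex_scope.
Variable R : realType.
Implicit Types z w : R[i].

Lemma sqr_cabs z : (cabs z ^+ 2)%:C = z * conjc z.
Proof.
case: z => a b; rewrite /cabs /= sqr_sqrtr ?addr_ge0 ?sqr_ge0 //.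
by congr (_ +i* _); ring.
Qed.

Lemma cabs_ge0 z : 0 <= cabs z.
Proof. by case: z => a b; exact: sqrtr_ge0. Qed.

Lemma cabsM z w : cabs (z * w) = cabs z * cabs w.
Proof. exact: ComplexField.Normc.normcM. Qed.

Lemma cabs0 : cabs (0 : R[i]) = 0.
Proof. exact: ComplexField.Normc.normc0. Qed.

Lemma cabs1 : cabs (1 : R[i]) = 1.
Proof. exact: ComplexField.Normc.normc1. Qed.

Lemma cabs_conj z : cabs (conjc z) = cabs z.
Proof. by case: z => a b; rewrite /cabs /= sqrrN. Qed.

Lemma cabsX z n : cabs (z ^+ n) = cabs z ^+ n.
Proof. by elim: n => [|n IHn]; rewrite ?cabs1 // !exprS cabsM IHn. Qed.

Lemma cabs_real (x : R) : 0 <= x -> cabs x%:C = x.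
Proof. by move=> x0; rewrite /cabs /= expr0n addr0 sqrtr_sqr ger0_norm. Qed.

Lemma ler_cabsD z w : cabs (z + w) <= cabs z + cabs w.
Proof. exact: le_normcD. Qed.

Lemma ler_cabs_sum (I : Type) (r : seq I) (F : I -> R[i]) :
  cabs (\sum_(i <- r) F i) <= \sum_(i <- r) cabs (F i).
Proof.
elim/big_ind2: _ => // [|z x w y zx wy]; first by rewrite cabs0.
exact: le_trans (ler_cabsD _ _) (lerD zx wy).
Qed.

Lemma ler_Re_cabs z : complex.Re z <= cabs z.
Proof.
case: z => a b; apply: le_trans (ler_norm _) _.
by rewrite -sqrtr_sqr /= ler_wsqrtr // lerDl sqr_ge0.
Qed.

Lemma sqr_cabsD z w : cabs (z + w) ^+ 2 <= 2 * cabs z ^+ 2 + 2 * cabs w ^+ 2.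
Proof.
have z0 := cabs_ge0 z; have w0 := cabs_ge0 w; have := cabs_ge0 (z + w).
have := ler_cabsD z w; have := sqr_ge0 (cabs z - cabs w); nra.
Qed.

End ComplexModulus.

Section Sums.
Variable R : realFieldType.

Lemma cauchy_schwarz (I : Type) (r : seq I) (f g : I -> R) :
  (\sum_(i <- r) f i * g i) ^+ 2 <=
  (\sum_(i <- r) f i ^+ 2) * (\sum_(i <- r) g i ^+ 2).
Proof.
rewrite expr2 !big_distrlr /= -subr_ge0 -(pmulr_rge0 _ (ltr0Sn R 1)).
suff -> : 2 * (\sum_(i <- r) \sum_(j <- r) f i ^+ 2 * g j ^+ 2 -
     \sum_(i <- r) \sum_(j <- r) f i * g i * (f j * g j))
  = \sum_(i <- r) \sum_(j <- r) (f i * g j - f j * g i) ^+ 2.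
  by do 2!apply: sumr_ge0 => ? _; apply: sqr_ge0.
rewrite mulrBr {1}mulrC mulrDr mulr1 {2}exchange_big /= -big_split mulr_sumr.
rewrite -sumrB; apply: eq_bigr => i _.
rewrite mulr_sumr -big_split /= -sumrB; apply: eq_bigr => j _; ring.
Qed.

Lemma sqr_sum_le (I : Type) (r : seq I) (f : I -> R) :
  (\sum_(i <- r) f i) ^+ 2 <= (size r)%:R * \sum_(i <- r) f i ^+ 2.
Proof.
have := cauchy_schwarz r f (fun=> 1).
rewrite expr1n big_const_seq count_predT iter_addr_0 mulrC.
by under eq_bigr do rewrite mulr1.
Qed.

(** Majorant principle: for a nonnegative summand, reindexing costs at most
    the largest multiplicity of the reindexing map. *)
Lemma sum_pushforward_le (I : Type) (K : eqType) (r : seq I) (s : seq K)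
    (phi : I -> K) (g : K -> R) (D : nat) :
    (forall k, 0 <= g k) -> all (fun i => phi i \in s) r ->
    (forall k, k \in s -> (count (fun i => phi i == k) r <= D)%N) ->
  \sum_(i <- r) g (phi i) <= D%:R * \sum_(k <- s) g k.
Proof.
move=> g_ge0 rs cnt.
apply: (@le_trans _ _ (\sum_(i <- r) \sum_(k <- s | phi i == k) g k)).
  elim: r rs {cnt} => [|i r IHr] /=; first by rewrite !big_nil.
  case/andP=> is_ rs; rewrite !big_cons lerD ?IHr //.
  rewrite (perm_big _ (perm_to_rem is_)) big_cons eqxx lerDl.
  by apply: sumr_ge0 => k _.
under eq_bigr do rewrite big_mkcond.
rewrite exchange_big mulr_sumr /= big_seq [leRHS]big_seq; apply: ler_sum => k ks.
rewrite -big_mkcond -big_filter big_const_seq count_predT iter_addr_0.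
by rewrite -[leLHS]mulr_natl ler_wpM2r // ler_nat size_filter cnt.
Qed.

End Sums.

(** A factorization k = a b is determined by the divisor a. *)
Lemma count_mul_le X Y k : (0 < k)%N ->
  (count (fun ab => ab.1 * ab.2 == k)%N
    [seq (a, b) | a <- iota 1 X, b <- iota 1 Y] <= num_divisors k)%N.
Proof.
move=> k_gt0; rewrite -size_filter -(size_map fst); apply: uniq_leq_size.
  rewrite map_inj_in_uniq ?filter_uniq //.
    by rewrite allpairs_uniq ?iota_uniq // => -[a b] [c d] _ _ [-> ->].
  move=> [a b] [c d]; rewrite !mem_filter /= => /andP[/eqP ab _].
  case/andP=> /eqP cd _ ac; move: cd ab; rewrite ac => cd ab.
  have c_gt0 : (0 < c)%N by move: k_gt0; rewrite -cd; case: (c).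
  by congr (_, _); apply/eqP; rewrite -(eqn_pmul2l c_gt0) cd ab.
move=> _ /mapP[[a b] + ->]; rewrite mem_filter /= => /andP[/eqP kE _].
by rewrite -dvdn_divisors // -kE dvdn_mulr.
Qed.

Section Correlation.
Local Open Scope complex_scope.
Variables (R : realType) (q : nat).
Local Notation char := {ffun 'Z_q -> R[i]}.
Implicit Types (A B : seq char) (x y : 'Z_q).

Definition correlation A x y : R[i] := \sum_(chi <- A) chi x * conjc (chi y).

(** Expanding the square turns a mean square over characters into a
    bilinear form in the coefficients, whose kernel depends on the characters
    only through their correlations. *)
Lemma duality (I : Type) (r : seq I) (a : I -> R[i]) (phi : I -> 'Z_q) A B :
  (\sum_(psi <- B) \sum_(chi <- A)
     cabs (\sum_(i <- r) a i * (psi (phi i) * conjc (chi (phi i)))) ^+ 2)%:C =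
  \sum_(i <- r) \sum_(j <- r) a i * conjc (a j) *
    (correlation B (phi i) (phi j) * conjc (correlation A (phi i) (phi j))).
Proof.
transitivity (\sum_(psi <- B) \sum_(chi <- A) \sum_(i <- r) \sum_(j <- r)
   a i * conjc (a j) * ((psi (phi i) * conjc (psi (phi j))) *
     conjc (chi (phi i) * conjc (chi (phi j))))).
  rewrite rmorph_sum; apply: eq_bigr => psi _.
  rewrite rmorph_sum; apply: eq_bigr => chi _.
  apply: etrans (sqr_cabs _) _; rewrite rmorph_sum big_distrlr /=.
  apply: eq_bigr => i _; apply: eq_bigr => j _; rewrite !rmorphM /= !conjcK; ring.
under eq_bigr do rewrite exchange_big.
rewrite exchange_big; apply: eq_bigr => i _ /=.
under eq_bigr do rewrite exchange_big.
rewrite exchange_big; apply: eq_bigr => j _ /=.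
rewrite /correlation rmorph_sum big_distrlr mulr_sumr /=.
by apply: eq_bigr => psi _; rewrite mulr_sumr.
Qed.

(** For nonnegative weights the right-hand side is monotone in the weights;
    this is what allows an interval to be replaced by a smooth majorant. *)
Lemma duality_real (I : Type) (r : seq I) (w : I -> R) (phi : I -> 'Z_q) A :
  \sum_(psi <- A) \sum_(chi <- A)
     cabs (\sum_(i <- r) (w i)%:C * (psi (phi i) * conjc (chi (phi i)))) ^+ 2 =
  \sum_(i <- r) \sum_(j <- r) w i * w j *
    cabs (correlation A (phi i) (phi j)) ^+ 2.
Proof.
apply: complexI; rewrite duality rmorph_sum; apply: eq_bigr => i _.
rewrite rmorph_sum; apply: eq_bigr => j _.
by rewrite -sqr_cabs conjc_real !rmorphM.
Qed.

(** Of the two forms of the energy, the one with nonnegative terms; the other,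
    [energyE], is a mean square of character sums. *)
Definition energy A (N : nat) : R :=
  \sum_(1 <= m < N.+1) \sum_(1 <= n < N.+1)
    cabs (correlation A m%:R n%:R) ^+ 2.

Lemma energyE A N :
  energy A N = \sum_(psi <- A) \sum_(chi <- A)
    cabs (\sum_(1 <= n < N.+1) psi n%:R * conjc (chi n%:R)) ^+ 2.
Proof.
rewrite /energy.
have := duality_real (index_iota 1 N.+1) (fun=> 1) (fun n => n%:R) A.
under eq_bigr do under eq_bigr do under eq_bigr do rewrite rmorph1 mul1r.
by move=> ->; under [RHS]eq_bigr do under eq_bigr do rewrite mulr1 mul1r.
Qed.

Lemma energy_ge0 A N : 0 <= energy A N.
Proof. by apply: sumr_ge0 => m _; apply: sumr_ge0 => n _; exact: sqr_ge0. Qed.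

(** The majorant principle for the energy, applied in each of the two
    variables; hence the square of the multiplicity. *)
Lemma energy_pushforward A N (I : Type) (r : seq I) (phi : I -> nat) D :
    all (fun i => phi i \in index_iota 1 N.+1) r ->
    (forall k, k \in index_iota 1 N.+1 ->
       (count (fun i => phi i == k) r <= D)%N) ->
  \sum_(i <- r) \sum_(j <- r) cabs (correlation A (phi i)%:R (phi j)%:R) ^+ 2
  <= D%:R ^+ 2 * energy A N.
Proof.
move=> rN cnt; rewrite expr2 -mulrA.
apply: (@le_trans _ _ (D%:R * \sum_(m <- index_iota 1 N.+1) \sum_(j <- r)
   cabs (correlation A m%:R (phi j)%:R) ^+ 2)).
  apply: (sum_pushforward_le (g := fun m : nat => \sum_(j <- r)
     cabs (correlation A m%:R (phi j)%:R) ^+ 2)) => // k.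
  by apply: sumr_ge0 => j _; exact: sqr_ge0.
rewrite ler_wpM2l ?ler0n // mulr_sumr; apply: ler_sum => m _.
apply: (sum_pushforward_le
  (g := fun n : nat => cabs (correlation A m%:R n%:R) ^+ 2)) => // k.
exact: sqr_ge0.
Qed.

End Correlation.

(** * Dirichlet characters, dilation and squaring *)

Section Characters.
Local Open Scope complex_scope.
Variables (R : realType) (q : nat).
Local Notation char := {ffun 'Z_q -> R[i]}.
Implicit Types (chi psi : char) (A B : seq char) (x y : 'Z_q).

(** A unit has finite multiplicative order, so its image is a root of
    unity. *)
Lemma char_unit_norm chi x : dirichlet_character chi -> x \is a GRing.unit ->
  cabs (chi x) = 1.
Proof.
move=> [chi1 chiM _] ux; pose u := FinRing.unit 'Z_q ux.
have uX : x ^+ #[u]%g = 1.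
  by rewrite -[x]/(FinRing.uval u) -FinRing.val_unitX expg_order.
have chiX n : chi (x ^+ n) = chi x ^+ n.
  by elim: n => [|n IHn]; rewrite ?chi1 // !exprS chiM IHn.
have : cabs (chi x) ^+ #[u]%g = 1 by rewrite -cabsX -chiX uX chi1 cabs1.
by move/eqP; rewrite pexpr_eq1 ?order_gt0 ?cabs_ge0 // => /eqP.
Qed.

Lemma char_unitK chi x : dirichlet_character chi -> x \is a GRing.unit ->
  chi x * conjc (chi x) = 1.
Proof. by move=> chiP ux; rewrite -sqr_cabs char_unit_norm // expr1n. Qed.

Lemma char_mulK chi psi x : dirichlet_character chi -> dirichlet_character psi ->
  charM chi psi x * conjc (psi x) = chi x.
Proof.
move=> [_ _ chi0] psiP; rewrite ffunE -mulrA.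
have [ux|nux] := boolP (x \is a GRing.unit); first by rewrite char_unitK ?mulr1.
by rewrite chi0 // mul0r.
Qed.

Lemma charM_dirichlet chi psi : dirichlet_character chi ->
  dirichlet_character psi -> dirichlet_character (charM chi psi).
Proof.
move=> [chi1 chiM chi0] [psi1 psiM psi0]; split.
- by rewrite ffunE chi1 psi1 mulr1.
- by move=> x y; rewrite !ffunE chiM psiM mulrACA.
- by move=> x nux; rewrite ffunE chi0 // mul0r.
Qed.

(** Equivalently, psi conj(chi) is a nontrivial character as soon as psi and
    chi differ: only the diagonal escapes the reflection through Gauss
    sums. *)
Lemma char_div_inj chi psi : dirichlet_character chi ->
    dirichlet_character psi ->
    (forall x, x \is a GRing.unit -> chi x * conjc (psi x) = 1) -> chi = psi.
Proof.
move=> [_ _ chi0] psiP chi_psi; apply/ffunP => x.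
have [ux|nux] := boolP (x \is a GRing.unit).
  rewrite -[RHS]mul1r -(chi_psi x ux) -mulrA [X in _ * X]mulrC.
  by rewrite char_unitK ?mulr1.
by case: psiP => _ _ psi0; rewrite chi0 // psi0.
Qed.

(** Correlations depend on the quotient x / y only. *)
Lemma correlation_dilate A (u x y : 'Z_q) :
    {in A, forall chi, dirichlet_character chi} -> u \is a GRing.unit ->
  correlation A (u * x) (u * y) = correlation A x y.
Proof.
move=> AP uu; apply: eq_big_seq => chi chiA; have chiP := AP _ chiA.
have [_ chiM _] := chiP.
by rewrite !chiM rmorphM mulrACA char_unitK ?mul1r.
Qed.

(** Cauchy-Schwarz over the pairs of characters brings in the fourth power of
    each character sum, that is the square of its square, which is a sum over
    the products of two integers up to L.  Each product is taken at most D
    times. *)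
Lemma energy_holder A L D : {in A, forall chi, dirichlet_character chi} ->
    (forall k, (0 < k <= L * L)%N -> (num_divisors k <= D)%N) ->
  energy A L ^+ 2 <= (size A)%:R ^+ 2 * D%:R ^+ 2 * energy A (L * L).
Proof.
move=> AP tauD.
set pairs := [seq (a, b) | a <- iota 1 L, b <- iota 1 L].
pose AA := [seq (psi, chi) | psi <- A, chi <- A].
pose s (pc : char * char) := \sum_(1 <= n < L.+1) pc.1 n%:R * conjc (pc.2 n%:R).
have -> : energy A L = \sum_(pc <- AA) cabs (s pc) ^+ 2.
  by rewrite energyE big_allpairs.
apply: le_trans (sqr_sum_le _ _) _.
rewrite size_allpairs natrM -expr2 -mulrA ler_wpM2l ?sqr_ge0 //.
have -> : \sum_(pc <- AA) (cabs (s pc) ^+ 2) ^+ 2 =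
  \sum_(i <- pairs) \sum_(j <- pairs)
    cabs (correlation A (i.1 * i.2)%:R (j.1 * j.2)%:R) ^+ 2.
  have := duality_real pairs (fun=> 1) (fun i => (i.1 * i.2)%:R) A.
  under [in X in _ = X -> _]eq_bigr do under eq_bigr do rewrite mulr1 mul1r.
  move=> <-; rewrite big_allpairs_dep.
  apply: eq_big_seq => psi psiA; apply: eq_big_seq => chi chiA.
  have [_ psiM _] := AP _ psiA; have [_ chiM _] := AP _ chiA.
  rewrite [cabs _ ^+ 2]expr2 -cabsM; congr (cabs _ ^+ 2).
  rewrite big_distrlr big_allpairs_dep /= /index_iota subn1 /=.
  apply: eq_bigr => m _; apply: eq_bigr => n _.
  by rewrite rmorph1 mul1r natrM psiM chiM rmorphM mulrACA.
apply: energy_pushforward.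
  apply/allP => _ /allpairsP[[a b] /= [+ + ->]]; rewrite mem_index_iota.
  rewrite !mem_iota => /andP[a0 aL] /andP[b0 bL].
  by rewrite muln_gt0 a0 b0 ltnS leq_mul.
move=> k; rewrite mem_index_iota => /andP[k0 kL].
by apply: leq_trans (count_mul_le _ _ k0) _; rewrite tauD ?k0.
Qed.

Lemma prime_unit (x : 'Z_q) : prime q -> x != 0 -> x \is a GRing.unit.
Proof.
move=> q_pr x0; have q1 := prime_gt1 q_pr.
rewrite -(natr_Zp x) unitZpE // prime_coprime // gtnNdvd //.
  by rewrite lt0n; apply: contra x0 => /eqP e; apply/eqP/val_inj.
by rewrite -[ltnRHS](Zp_cast q1) ltn_ord.
Qed.

(** Multiply both variables by each p <= P: this maps the pairs up to N to
    pairs up to M with the same correlation.  For given (p, m) the map n -> p n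
    is injective, and p m takes each value at most D times. *)
Lemma energy_dilate A N P M D : prime q ->
    {in A, forall chi, dirichlet_character chi} -> (P < q)%N -> (P * N <= M)%N ->
    (forall k, (0 < k <= M)%N -> (num_divisors k <= D)%N) ->
  P%:R * energy A N <= D%:R * energy A M.
Proof.
move=> q_pr AP Pq PNM tauD; have q1 := prime_gt1 q_pr.
pose g m n := cabs (correlation A m%:R n%:R) ^+ 2.
have g0 m n : 0 <= g m n by exact: sqr_ge0.
pose pairs := [seq (p, m) | p <- iota 1 P, m <- iota 1 N].
have le_mul p m : p \in iota 1 P -> m \in iota 1 N ->
    (p * m)%N \in index_iota 1 M.+1.
  rewrite mem_index_iota !mem_iota => /andP[p0 pP] /andP[m0 mN].
  by rewrite muln_gt0 p0 m0 ltnS (leq_trans _ PNM) // leq_mul.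
(* First enlarge the inner sum over p n to a sum over all integers up to M. *)
apply: (@le_trans _ _
    (\sum_(i <- pairs) \sum_(1 <= n < M.+1) g (i.1 * i.2)%N n)).
  rewrite big_allpairs_dep /= -[X in X%:R * _](size_iota 1).
  rewrite mulr_natl -[leLHS]iter_addr_0 -(count_predT (iota 1 P)) -big_const_seq.
  rewrite big_seq [leRHS]big_seq; apply: ler_sum => p pP.
  rewrite /energy /index_iota subn1 /= big_seq [leRHS]big_seq.
  apply: ler_sum => m mN.
  have up : (p%:R : 'Z_q) \is a GRing.unit.
    move: pP; rewrite mem_iota => /andP[p0 pP].
    by rewrite unitZpE // prime_coprime // gtnNdvd // (leq_ltn_trans _ Pq).
  rewrite subn1 /=.
  rewrite (eq_bigr (fun n => g (p * m)%N (p * n)%N)); last first.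
    by move=> n _; rewrite /g !natrM correlation_dilate.
  rewrite -[leRHS]mul1r.
  apply: (@sum_pushforward_le _ _ _ _ _
    (fun n => (p * n)%N) (g (p * m)%N) 1) => //.
    by apply/allP => n nN; have := le_mul p n pP nN; rewrite /index_iota subn1.
  move=> k _; apply: (@leq_trans (count_mem k [seq (p * n)%N | n <- iota 1 N])).
    by rewrite count_map.
  rewrite count_uniq_mem ?leq_b1 // map_inj_uniq ?iota_uniq // => a b /eqP.
  by rewrite eqn_pmul2l; [move/eqP|move: pP; rewrite mem_iota => /andP[]].
apply: (sum_pushforward_le (phi := fun i => (i.1 * i.2)%N)
    (g := fun m => \sum_(1 <= n < M.+1) g m n)).
- by move=> m; apply: sumr_ge0.
- by apply/allP => _ /allpairsP[[p m] /= [pP mN ->]]; exact: le_mul.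
- move=> k; rewrite mem_index_iota => /andP[k0 kM].
  by apply: leq_trans (count_mul_le _ _ k0) _; rewrite tauD ?k0.
Qed.

End Characters.

(** * Gauss sums *)

Section AdditiveCharacter.
Local Open Scope complex_scope.
Variables (R : realType) (q : nat).
Hypothesis q_pr : prime q.
Let q1 : (1 < q)%N := prime_gt1 q_pr.
Let qR_gt0 : (0 : R) < q%:R. Proof. by rewrite ltr0n prime_gt0. Qed.
Implicit Types x y : 'Z_q.

Definition zeta : R[i] := cos (2 * pi / q%:R) +i* sin (2 * pi / q%:R).

Lemma zetaX n : zeta ^+ n = cos (2 * pi / q%:R *+ n) +i* sin (2 * pi / q%:R *+ n).
Proof.
elim: n => [|n IHn]; first by rewrite expr0 mulr0n cos0 sin0.
by rewrite exprS IHn (mulrS _ n) cosD sinD [sin _ * _ + _]addrC.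
Qed.

Lemma zetaXq : zeta ^+ q = 1.
Proof.
rewrite zetaX -mulr_natr mulfVK ?gt_eqF // mulr_natl.
by rewrite cos2pi sin2pi.
Qed.

Lemma zeta_neq1 : zeta != 1.
Proof.
rewrite /zeta eq_complex /= negb_and; apply/orP; left.
have -> : 2 * pi / q%:R = (pi / q%:R) *+ 2 :> R by rewrite -mulrA mulr_natl.
rewrite cos_mulr2n cos2sin2.
have: 0 < sin (pi / q%:R) :> R.
  apply: sin_gt0_pi; rewrite divr_gt0 ?pi_gt0 //=.
  by rewrite ltr_pdivrMr // ltr_pMr ?pi_gt0 // ltr1n.
move=> s0; apply/negP => /eqP E; have := mulr_gt0 s0 s0; nra.
Qed.

Lemma zeta_norm n : zeta ^+ n * conjc (zeta ^+ n) = 1.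
Proof.
rewrite -sqr_cabs zetaX /cabs /= sqr_sqrtr ?addr_ge0 ?sqr_ge0 //.
by rewrite cos2Dsin2.
Qed.

Definition addchar x : R[i] := zeta ^+ (x : nat).

Lemma addchar_nat n : addchar n%:R = zeta ^+ n.
Proof. by rewrite /addchar val_Zp_nat // expr_mod // zetaXq. Qed.

Lemma addcharD x y : addchar (x + y) = addchar x * addchar y.
Proof.
rewrite -(natr_Zp x) -(natr_Zp y) -natrD !addchar_nat; exact: exprD.
Qed.

Lemma addcharN x : addchar (- x) = conjc (addchar x).
Proof.
rewrite -[LHS]mulr1 -(zeta_norm x) mulrA -addcharD addNr.
by rewrite (addchar_nat 0) expr0 mul1r.
Qed.

(** Orthogonality: translating y by 1 multiplies the sum over y of e(y) by
    [zeta], which is not 1. *)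
Lemma sum_addchar x : \sum_y addchar (x * y) = if x == 0 then q%:R else 0.
Proof.
case: eqP => [->|/eqP x0].
  under eq_bigr do rewrite mul0r (addchar_nat 0) expr0.
  by rewrite sumr_const card_ord Zp_cast.
have ux := prime_unit q_pr x0.
have -> : \sum_y addchar (x * y) = \sum_y addchar y.
  rewrite [RHS](reindex (fun y => x * y)) //.
  by exists (fun y => x^-1 * y) => y _; rewrite (mulKr, mulVKr).
set s := \sum_y _; have: zeta * s = s.
  rewrite mulr_sumr [RHS](reindex_inj (addrI 1)) /=.
  by apply: eq_bigr => y _; rewrite addcharD (addchar_nat 1) expr1.
move/eqP; rewrite -subr_eq0 -[X in _ - X]mul1r -mulrBl mulf_eq0 subr_eq0.
by rewrite (negPf zeta_neq1) => /eqP.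
Qed.

Section Gauss.
Variable psi : {ffun 'Z_q -> R[i]}.
Hypothesis psiP : dirichlet_character psi.
Hypothesis psi_neq1 : exists2 u, u \is a GRing.unit & psi u != 1.

Definition gauss x : R[i] := \sum_y psi y * addchar (x * y).

(** A nontrivial character is an eigenvector of the Fourier transform up to
    conjugation.  For x = 0 both sides vanish, by nontriviality. *)
Lemma gaussE x : gauss x = conjc (psi x) * gauss 1.
Proof.
have [_ psiM psi0] := psiP; have [ux|nux] := boolP (x \is a GRing.unit).
  suff -> : gauss 1 = psi x * gauss x.
    by rewrite mulrA [_ * psi x]mulrC char_unitK // mul1r.
  rewrite /gauss (reindex (fun y => x * y)) /=; last first.
    by exists (fun y => x^-1 * y) => y _; rewrite (mulKr, mulVKr).
  by rewrite mulr_sumr; apply: eq_bigr => y _; rewrite psiM mul1r mulrA.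
have x0 : x = 0 by apply/eqP; apply: contraNT nux; exact: prime_unit.
rewrite psi0 // conjc0 mul0r; have [u uu psiu] := psi_neq1.
have: psi u * gauss x = gauss x.
  rewrite x0 /gauss [RHS](reindex (fun y => u * y)) /=; last first.
    by exists (fun y => u^-1 * y) => y _; rewrite (mulKr, mulVKr).
  by rewrite mulr_sumr; apply: eq_bigr => y _; rewrite psiM !mul0r mulrA.
move/eqP; rewrite -subr_eq0 -[X in _ - X]mul1r -mulrBl mulf_eq0 subr_eq0.
by rewrite (negPf psiu) => /eqP.
Qed.

(** Parseval: by [gaussE] all the Gauss sums at nonzero points have the same
    modulus. *)
Lemma gauss_norm : cabs (gauss 1) ^+ 2 = q%:R.
Proof.
have [psi1 psiM psi0] := psiP.
set s := \sum_y cabs (psi y) ^+ 2.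
have s_gt0 : 0 < s.
  rewrite /s (bigD1 1) //= psi1 cabs1 expr1n ltr_pwDl ?sumr_ge0 // => i _.
  exact: sqr_ge0.
suff E : cabs (gauss 1) ^+ 2 * s = q%:R * s by apply: (mulIf (lt0r_neq0 s_gt0)).
rewrite {1}/s mulr_sumr.
rewrite (eq_bigr (fun x => cabs (gauss x) ^+ 2)); last first.
  by move=> x _; rewrite (gaussE x) cabsM cabs_conj exprMn mulrC.
apply: complexI; rewrite rmorph_sum /=.
transitivity (\sum_x \sum_y \sum_z
  (psi y * conjc (psi z)) * addchar ((y - z) * x)).
  apply: eq_bigr => x _; apply: etrans (sqr_cabs _) _.
  rewrite rmorph_sum big_distrlr /=; apply: eq_bigr => y _; apply: eq_bigr => z _.
  rewrite rmorphM /= mulrACA -addcharN -addcharD; congr (_ * addchar _).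
  by rewrite mulrBl (mulrC y) (mulrC z).
have -> : (q%:R * s)%:C = \sum_y (cabs (psi y) ^+ 2)%:C * q%:R.
  by rewrite rmorphM rmorph_nat rmorph_sum mulrC mulr_suml.
rewrite exchange_big; apply: eq_bigr => y _ /=.
rewrite exchange_big (bigD1 y) //= [X in _ + X]big1; last first.
  by move=> z zy; rewrite -mulr_sumr sum_addchar subr_eq0 eq_sym (negPf zy) mulr0.
by rewrite -mulr_sumr sum_addchar subrr eqxx addr0 -sqr_cabs.
Qed.

End Gauss.
End AdditiveCharacter.

(** * Reflection *)

Section Reflection.
Local Open Scope complex_scope.
Variables (R : realType) (q : nat).
Hypothesis q_pr : prime q.
Let q1 : (1 < q)%N := prime_gt1 q_pr.
Let qR_gt0 : (0 : R) < q%:R. Proof. by rewrite ltr0n prime_gt0. Qed.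
Local Notation char := {ffun 'Z_q -> R[i]}.
Implicit Types (x y : 'Z_q) (A : seq char).
Local Notation e := (@addchar R q).

(** The Fejer kernel, normalized to be of order 1 near 0.  As a trigonometric
    polynomial of degree less than [H] it is band-limited. *)
Definition fejer H x : R :=
  cabs (\sum_(0 <= h < H) e (h%:R * x)) ^+ 2 / H%:R ^+ 2.

Lemma fejerE H x : (fejer H x)%:C =
  (H%:R ^+ 2)^-1 * \sum_(0 <= h < H) \sum_(0 <= k < H) e ((h%:R - k%:R) * x).
Proof.
have HV : ((H%:R ^+ 2)^-1)%:C = (H%:R ^+ 2)^-1 :> R[i].
  by rewrite fmorphV rmorphXn rmorph_nat.
rewrite /fejer rmorphM /= HV mulrC; congr (_ * _).
apply: etrans (sqr_cabs _) _; rewrite rmorph_sum big_distrlr /=.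
apply: eq_bigr => h _; apply: eq_bigr => k _.
by rewrite -addcharN // -addcharD // mulrBl.
Qed.

Lemma fejer_ge0 H x : 0 <= fejer H x.
Proof. by rewrite divr_ge0 ?sqr_ge0. Qed.

(** Here cos(2t) >= 0, so cos(t)^2 >= 1/2, and cos(t) >= cos(t)^2. *)
Lemma cos_ge_half (t : R) : 0 <= t <= pi / 4 -> 1 / 2 <= cos t.
Proof.
move=> /andP[t0 t4]; have pi0 : 0 < pi :> R := pi_gt0 _.
have c0 : 0 <= cos t by apply: cos_ge0_pihalf; apply/andP; split; lra.
have: 0 <= cos (t *+ 2).
  by apply: cos_ge0_pihalf; rewrite (mulr2n t); apply/andP; split; lra.
have c1 := cos_le1 t; rewrite cos_mulr2n (mulr2n (cos t ^+ 2)) expr2.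
by have := mulr_ge0 c0 (etrans (subr_ge0 _ _) c1); nra.
Qed.

(** All the phases 2 pi h n / q are at most pi/4, so the exponentials add up
    with real parts at least 1/2. *)
Lemma fejer_ge H N n : (0 < H)%N -> (0 < n <= N)%N -> (8 * (N * H.-1) <= q)%N ->
  1 / 4 <= fejer H n%:R.
Proof.
move=> H0 /andP[n0 nN] NHq; have HR0 : (0 : R) < H%:R by rewrite ltr0n.
rewrite /fejer ler_pdivlMr ?exprn_gt0 //.
suff: H%:R / 2 <= cabs (\sum_(0 <= h < H) e (h%:R * n%:R)).
  have -> : 1 / 4 * H%:R ^+ 2 = (H%:R / 2) ^+ 2 :> R by field.
  by move=> cH; rewrite lerXn2r ?nnegrE ?cabs_ge0 // divr_ge0.
apply: (le_trans _ (@ler_Re_cabs R _)).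
rewrite (raddf_sum (@complex.Re R : Rcomplex R -> R)).
have -> : H%:R / 2 = \sum_(0 <= h < H) (1 / 2 : R).
  by rewrite sumr_const_nat subn0 -[RHS]mulr_natl mul1r.
rewrite big_nat [leRHS]big_nat; apply: ler_sum => h /andP[_ hH].
rewrite -natrM addchar_nat // zetaX /=; apply: cos_ge_half.
rewrite mulrn_wge0 ?divr_ge0 ?mulr_ge0 ?pi_ge0 //= -mulr_natl natrM.
have : (8 * (h * n) <= q)%N.
  apply: leq_trans NHq; rewrite leq_mul2l /= mulnC leq_mul // -ltnS prednK //.
rewrite -(ler_nat R) !natrM => hnq.
rewrite mulrA ler_pdivrMr //; have := pi_gt0 R; nra.
Qed.

Lemma sum_fejer H : (0 < H <= q)%N -> \sum_x fejer H x = q%:R / H%:R.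
Proof.
move=> /andP[H0 Hq]; have HR0 : H%:R != 0 :> R[i] by rewrite pnatr_eq0 -lt0n.
apply: complexI; rewrite rmorph_sum /=.
under eq_bigr do rewrite fejerE.
rewrite -mulr_sumr exchange_big /=.
have -> : \sum_(0 <= h < H) \sum_x \sum_(0 <= k < H) e ((h%:R - k%:R) * x)
  = H%:R * q%:R.
  transitivity (\sum_(0 <= h < H) (q%:R : R[i])); last first.
    by rewrite sumr_const_nat subn0 mulr_natl.
  apply: eq_big_nat => h /andP[_ hH]; rewrite exchange_big /=.
  rewrite (bigD1_seq h) ?mem_index_iota ?iota_uniq //=.
  rewrite sum_addchar // subrr eqxx big_nat_cond big1 ?addr0 // => k.
  move=> /andP[/andP[_ kH] kh]; rewrite sum_addchar // subr_eq0.
  case: eqP => // /(congr1 val) /=.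
  rewrite !val_Zp_nat // !modn_small ?(leq_trans _ Hq) // => hk.
  by rewrite hk eqxx in kh.
rewrite rmorphM fmorphV !rmorph_nat; field.
by [].
Qed.

(** Only the positive differences are kept: they are the ones that are
    integers of an interval [1, H - 1]. *)
Definition decreasing_pairs H : seq (nat * nat) :=
  [seq hk <- [seq (h, k) | h <- iota 0 H, k <- iota 0 H] | (hk.2 < hk.1)%N].

Definition difference_sum H (f : 'Z_q -> R[i]) : R[i] :=
  \sum_(hk <- decreasing_pairs H) f (hk.1 - hk.2)%:R.

(** The negative differences contribute psi(-1) times the sum over the
    positive ones, and |psi(-1)| = 1; the diagonal vanishes. *)
Lemma sum_differences H (psi : char) : dirichlet_character psi ->
  cabs (\sum_(0 <= h < H) \sum_(0 <= k < H) psi (h%:R - k%:R)) ^+ 2 <=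
  4 * cabs (difference_sum H psi) ^+ 2.
Proof.
move=> psiP; have [psi1 psiM psi0] := psiP.
have uN1 : (-1 : 'Z_q) \is a GRing.unit by rewrite unitrN1.
have -> : \sum_(0 <= h < H) \sum_(0 <= k < H) psi (h%:R - k%:R) =
  difference_sum H psi + psi (-1) * difference_sum H psi.
  have tri (F : nat -> nat -> R[i]) :
      \sum_(hk <- decreasing_pairs H) F hk.1 hk.2 =
      \sum_(0 <= h < H) \sum_(0 <= k < H) if (k < h)%N then F h k else 0.
    rewrite big_filter big_mkcond big_allpairs_dep /= /index_iota subn0.
    by apply: eq_bigr.
  rewrite /difference_sum (tri (fun h k => psi (h - k)%:R)) mulr_sumr.
  rewrite (eq_bigr (fun h => \sum_(0 <= k < H)
    ((if (k < h)%N then psi (h - k)%:R else 0) +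
     (if (h < k)%N then psi (-1) * psi (k - h)%:R else 0)))); last first.
    move=> h _; apply: eq_bigr => k _.
    case: ltngtP => hk; rewrite ?addr0 ?add0r.
    - by rewrite natrB // ltnW.
    - by rewrite -psiM mulN1r natrB ?opprB // ltnW.
    - by rewrite hk subrr psi0 // unitr0.
  under eq_bigr do rewrite big_split.
  rewrite big_split /=; congr (_ + _); rewrite exchange_big.
  apply: eq_bigr => h _ /=; rewrite mulr_sumr; apply: eq_bigr => k _.
  by case: ifP; rewrite ?mulr0.
apply: le_trans (sqr_cabsD _ _) _.
by rewrite cabsM char_unit_norm // mul1r; lra.
Qed.

(** The Fourier expansion of the kernel and [gaussE] turn a character sum
    weighted by the kernel into one over the differences of integers below
    [H]. *)
Lemma fejer_sum_nontrivial_le H (psi : char) : dirichlet_character psi ->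
    (exists2 u, u \is a GRing.unit & psi u != 1) -> (0 < H)%N ->
  cabs (\sum_x (fejer H x)%:C * psi x) ^+ 2 <=
  4 * q%:R / H%:R ^+ 4 * cabs (difference_sum H psi) ^+ 2.
Proof.
move=> psiP psi_neq1 H0; have HR0 : (0 : R) < H%:R by rewrite ltr0n.
have -> : \sum_x (fejer H x)%:C * psi x = (H%:R ^- 2)%:C * gauss psi 1 *
   conjc (\sum_(0 <= h < H) \sum_(0 <= k < H) psi (h%:R - k%:R)).
  under eq_bigr do rewrite fejerE -mulrA.
  rewrite -mulr_sumr -mulrA fmorphV rmorphXn rmorph_nat; congr (_ * _).
  under eq_bigr do rewrite mulr_suml.
  rewrite exchange_big rmorph_sum mulr_sumr; apply: eq_bigr => h _ /=.
  under eq_bigr do rewrite mulr_suml.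
  rewrite exchange_big rmorph_sum mulr_sumr; apply: eq_bigr => k _ /=.
  by rewrite mulrC -gaussE //; apply: eq_bigr => x _; rewrite mulrC.
rewrite !cabsM cabs_conj !exprMn gauss_norm // cabs_real ?invr_ge0 ?sqr_ge0 //.
have := sum_differences H psiP.
set b := cabs (difference_sum H psi) ^+ 2 => ab.
have -> : 4 * q%:R / H%:R ^+ 4 * b = (H%:R ^- 2) ^+ 2 * q%:R * (4 * b) :> R.
  by field; rewrite gt_eqF.
by rewrite ler_wpM2l // mulr_ge0 ?sqr_ge0.
Qed.

(** This trivial bound serves for the diagonal pairs psi = chi, where psi
    conj(chi) is trivial and Gauss sums give nothing. *)
Lemma fejer_sum_le H (psi : char) : dirichlet_character psi ->
    (0 < H <= q)%N ->
  cabs (\sum_x (fejer H x)%:C * psi x) ^+ 2 <= (q%:R / H%:R) ^+ 2.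
Proof.
move=> psiP Hq; have [_ _ psi0] := psiP.
rewrite lerXn2r ?nnegrE ?cabs_ge0 ?divr_ge0 // -sum_fejer //.
apply: le_trans (ler_cabs_sum _ _) _; apply: ler_sum => x _.
rewrite cabsM cabs_real ?fejer_ge0 // ler_piMr ?fejer_ge0 //.
have [ux|nux] := boolP (x \is a GRing.unit); first by rewrite char_unit_norm.
by rewrite psi0 // cabs0.
Qed.

Definition conj_char (chi : char) : char := [ffun x => conjc (chi x)].

Lemma conj_char_dirichlet chi : dirichlet_character chi ->
  dirichlet_character (conj_char chi).
Proof.
move=> [chi1 chiM chi0]; split.
- by rewrite ffunE chi1 conjc1.
- by move=> x y; rewrite !ffunE chiM rmorphM.
- by move=> x nux; rewrite ffunE chi0 // conjc0.
Qed.

(** A difference h - k with k < h <= L lies in [1, L] and, being determined by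
    k, is taken at most L + 1 times. *)
Lemma difference_sum_energy A L : {in A, forall chi, dirichlet_character chi} ->
  \sum_(psi <- A) \sum_(chi <- A)
     cabs (difference_sum L.+1 (charM psi (conj_char chi))) ^+ 2 <=
  L.+1%:R ^+ 2 * energy A L.
Proof.
move=> AP; have := duality_real (decreasing_pairs L.+1) (fun=> 1)
  (fun hk => (hk.1 - hk.2)%:R) A.
under [in X in _ = X -> _]eq_bigr do under eq_bigr do rewrite mulr1 mul1r.
under [in X in X = _ -> _]eq_bigr do under eq_bigr do
  under eq_bigr do rewrite rmorph1 mul1r.
have E psi chi : difference_sum L.+1 (charM psi (conj_char chi)) =
    \sum_(hk <- decreasing_pairs L.+1)
       psi (hk.1 - hk.2)%:R * conjc (chi (hk.1 - hk.2)%:R).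
  by apply: eq_bigr => hk _; rewrite !ffunE.
under [in X in _ -> X <= _]eq_bigr do under eq_bigr do rewrite E.
move=> ->; apply: energy_pushforward.
  apply/allP => -[h k]; rewrite mem_filter => /andP[kh].
  move=> /allpairsP[[h' k'] [hL _ [hh _]]].
  move: hL; rewrite /fst -hh mem_iota => /andP[_ hL].
  by rewrite mem_index_iota subn_gt0 kh ltnS (leq_trans (leq_subr _ _)).
move=> d _; rewrite -size_filter -(size_map snd) -[leqRHS](size_iota 0).
apply: uniq_leq_size.
  rewrite map_inj_in_uniq ?filter_uniq //.
    by rewrite allpairs_uniq ?iota_uniq // => -[a b] [c f] _ _ [-> ->].
  move=> [h k] [h' k']; rewrite !mem_filter /= => /and3P[/eqP hk lt _].
  case/and3P=> /eqP hk' lt' _ kk; congr (_, _) => //.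
  by rewrite -(subnK (ltnW lt)) hk -hk' kk subnK // ltnW.
move=> _ /mapP[[h k] + ->]; rewrite !mem_filter => /and3P[_ _].
by case/allpairsP=> -[h' k'] /= [_ + [_ ->]].
Qed.

(** Majorize the indicator function of [1, N] by 4 times the kernel in both
    variables and pass to the mean square over pairs of characters.  The
    diagonal pairs give the first term; for the others, Gauss sums lead to the
    energy of the dual interval.  The condition on N and L keeps the kernel
    large on [1, N]. *)
Lemma energy_reflect A N L : {in A, forall chi, dirichlet_character chi} ->
    uniq A -> (N <= q)%N -> (L < q)%N -> (8 * (N * L) <= q)%N ->
  energy A N <= 16 * ((size A)%:R * q%:R ^+ 2 / L.+1%:R ^+ 2 +
                 4 * q%:R / L.+1%:R ^+ 2 * energy A L).
Proof.
move=> AP uniqA Nq Lq NLq; set H := L.+1.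
have HR0 : (0 : R) < H%:R by rewrite ltr0n.
pose w := fejer H; pose g x y := cabs (correlation A x y) ^+ 2.
have w_ge0 x : 0 <= w x by exact: fejer_ge0.
have g_ge0 x y : 0 <= g x y by exact: sqr_ge0.
(* As N <= q, distinct integers of [1, N] are distinct modulo q. *)
have inj_cnt (k : 'Z_q) :
    (count (fun n : nat => n%:R == k) (index_iota 1 N.+1) <= 1)%N.
  apply: (@leq_trans (count_mem k [seq n%:R | n <- index_iota 1 N.+1])).
    by rewrite count_map.
  rewrite count_uniq_mem ?leq_b1 // map_inj_in_uniq ?iota_uniq // => a b.
  rewrite !mem_index_iota => /andP[a0 aN] /andP[b0 bN] /(congr1 val) /=.
  rewrite !val_Zp_nat // => ab.
  wlog ab' : a b a0 aN b0 bN ab / (a <= b)%N.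
    by move=> W; case: (leqP a b) => [|/ltnW] le; [|apply/esym]; apply: W.
  apply/eqP; rewrite eqn_leq ab' -subn_eq0 /=; move/eqP: ab.
  rewrite eq_sym eqn_mod_dvd // => q_dvd; apply: contraTT q_dvd => ba.
  rewrite gtnNdvd ?lt0n //; apply: leq_trans (@leq_trans N b q bN Nq).
  by rewrite ltn_subrL a0 b0.
have le1 : energy A N <= 16 * \sum_x \sum_y w x * w y * g x y.
  have w_big (n : nat) : n \in index_iota 1 N.+1 -> 1 / 4 <= w n%:R.
    by rewrite mem_index_iota => n_in; apply: (@fejer_ge H N).
  have in_enum (r : seq nat) :
      all (fun n : nat => (n%:R : 'Z_q) \in index_enum 'Z_q) r.
    by apply/allP => n _; exact: mem_index_enum.
  apply: (@le_trans _ _ (16 * \sum_(1 <= m < N.+1) \sum_(1 <= n < N.+1)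
      w m%:R * w n%:R * g m%:R n%:R)).
    rewrite mulr_sumr [leLHS]big_seq [leRHS]big_seq; apply: ler_sum => m mN.
    rewrite mulr_sumr [leLHS]big_seq [leRHS]big_seq; apply: ler_sum => n nN.
    rewrite mulrA -[leLHS]mul1r ler_wpM2r ?g_ge0 //.
    by have := w_big _ mN; have := w_big _ nN; nra.
  rewrite ler_wpM2l //.
  apply: (@le_trans _ _
      (\sum_x \sum_(1 <= n < N.+1) w x * w n%:R * g x n%:R)).
    rewrite -[leRHS]mul1r.
    apply: (sum_pushforward_le (D := 1) (phi := fun m : nat => m%:R)
      (g := fun x : 'Z_q => \sum_(1 <= n < N.+1) w x * w n%:R * g x n%:R)) => //.
    move=> x; apply: sumr_ge0 => n _.
    by apply: mulr_ge0; [apply: mulr_ge0; exact: fejer_ge0 | exact: sqr_ge0].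
  apply: ler_sum => x _; rewrite -[leRHS]mul1r.
  apply: (sum_pushforward_le (D := 1) (phi := fun m : nat => m%:R)
    (g := fun y : 'Z_q => w x * w y * g x y)) => // y.
  by apply: mulr_ge0; [apply: mulr_ge0; exact: fejer_ge0 | exact: sqr_ge0].
apply: le_trans le1 _; rewrite ler_wpM2l //.
rewrite -(duality_real (index_enum 'Z_q) w id A).
apply: (@le_trans _ _ (\sum_(psi <- A) \sum_(chi <- A)
   ((if chi == psi then (q%:R / H%:R) ^+ 2 else 0) + 4 * q%:R / H%:R ^+ 4 *
     cabs (difference_sum H (charM psi (conj_char chi))) ^+ 2))).
  rewrite big_seq [leRHS]big_seq; apply: ler_sum => psi psiA.
  rewrite big_seq [leRHS]big_seq; apply: ler_sum => chi chiA.
  have psiP := AP _ psiA; have chiP := AP _ chiA.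
  have rhoP := charM_dirichlet psiP (conj_char_dirichlet chiP).
  set rho := charM psi (conj_char chi) in rhoP *.
  rewrite (eq_bigr (fun x => (w x)%:C * rho x)); last first.
    by move=> x _; rewrite !ffunE.
  have c_ge0 : 0 <= 4 * q%:R / H%:R ^+ 4 :> R by rewrite divr_ge0 ?mulr_ge0.
  case: eqP => [_|/eqP chi_psi].
    rewrite -[leLHS]addr0 lerD ?(mulr_ge0 c_ge0 (sqr_ge0 _)) //.
    by apply: fejer_sum_le => //; exact: ltnW.
  rewrite add0r; apply: fejer_sum_nontrivial_le => //.
  apply: contrapT => no_u; move/eqP: chi_psi; apply.
  apply/esym/char_div_inj => // x ux; apply/eqP/negPn/negP => neq1.
  by apply: no_u; exists x => //; rewrite !ffunE.
under eq_bigr do rewrite big_split -mulr_sumr /=.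
rewrite big_split -mulr_sumr /=; apply: lerD.
  rewrite (eq_big_seq (fun=> (q%:R / H%:R) ^+ 2)); last first.
    move=> psi psiA; rewrite (bigD1_seq psi) //= eqxx big1 ?addr0 // => chi.
    by move/negPf ->.
  rewrite big_const_seq count_predT iter_addr_0 -[leLHS]mulr_natl.
  by rewrite expr_div_n mulrA.
apply: le_trans (ler_wpM2l _ (difference_sum_energy _ AP)) _.
  by rewrite divr_ge0 ?mulr_ge0.
rewrite le_eqVlt; apply/orP; left; apply/eqP; rewrite -/H; field.
by rewrite gt_eqF.
Qed.

End Reflection.

(** * Heath-Brown's bound *)

(** The length M1 to which M is dilated is the larger of M and the threshold
    M', cut at q; the dilation factors go up to P, about M1 / M.  The bound
    P < q keeps them invertible modulo q. *)
Lemma intermediate_length q M M' : (1 < q)%N -> (0 < M <= q)%N -> (0 < M')%N ->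
  exists M1 P, [/\ (0 < M1 <= q)%N /\ M1 = q \/ (0 < M1 <= q)%N /\ (M' <= M1)%N,
    (M1 <= M + M')%N, (P < q)%N, (P * M <= M1)%N & (M1 <= 2 * (M * P))%N].
Proof.
move=> q1 /andP[M0 Mq] M'0.
pose M1 := minn q (maxn M M'); exists M1, (minn (M1 %/ M) q.-1).
have MM1 : (M <= M1)%N by rewrite leq_min Mq leq_maxl.
have M1q : (M1 <= q)%N by exact: geq_minl.
have M1_gt0 : (0 < M1)%N by exact: leq_trans MM1.
split.
- have [h|h] : M1 = q \/ M1 = maxn M M' by rewrite /M1 /minn; case: ifP; auto.
    by left; split=> //; rewrite M1_gt0 M1q.
  by right; split; [rewrite M1_gt0 M1q|rewrite h leq_maxr].
- apply: leq_trans (geq_minr _ _) _.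
  by rewrite geq_max leq_addr leq_addl.
- by rewrite (leq_ltn_trans (geq_minr _ _)) // prednK // ltnW.
- by apply: leq_trans (leq_trunc_div M1 M); rewrite leq_mul2r geq_minl orbT.
clear M'0; have := ltn_ceil M1 M0; have : (0 < M1 %/ M)%N by rewrite divn_gt0.
rewrite /minn; case: ifP => _; first by move: (M1 %/ M)%N => d; clear -M0; nia.
by move=> _ _; clear -q1 M1q M0; nia.
Qed.

(** If t > 1 then 1 + t <= 2 t, hence t <= 2 B. *)
Lemma quadratic_bootstrap (R : realFieldType) (B t : R) :
  1 <= B -> 0 <= t -> t ^+ 2 <= B * (1 + t) -> t ^+ 2 <= (2 * B) ^+ 2.
Proof.
move=> B1 t0 tB; have B0 : 0 <= B by lra.
rewrite lerXn2r ?nnegrE ?mulr_ge0 //; have [t1|t1] := leP t 1; first by lra.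
rewrite -(ler_pM2r (lt_trans ltr01 t1)) -expr2; apply: le_trans tB _.
by rewrite (mulrC 2) -mulrA ler_wpM2l //; lra.
Qed.

Section Bootstrap.
(* Fractional powers of the number of characters and of q enter only through
   a and s, so that every inequality below is polynomial. *)
Variables (R : realType) (q D : nat) (A : seq {ffun 'Z_q -> R[i]}) (a s : R).
Hypothesis q_pr : prime q.
Hypothesis AP : {in A, forall chi, dirichlet_character chi}.
Hypothesis uniqA : uniq A.
Hypothesis tauD : forall k, (0 < k <= q)%N -> (num_divisors k <= D)%N.
Hypothesis a_ge1 : 1 <= a.
Hypothesis aE : a ^+ 4 = (size A)%:R.
Hypothesis s_ge0 : 0 <= s.
Hypothesis sE : s ^+ 2 = q%:R.
Let q1 : (1 < q)%N := prime_gt1 q_pr.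

(** The order of magnitude A M + A^2 + A^(5/4) q^(1/2) aimed at for the energy
    divided by the length. *)
Definition energy_scale (M : nat) : R := a ^+ 4 * M%:R + a ^+ 8 + a ^+ 5 * s.
Local Notation G := energy_scale.
Local Notation E := (energy A).

Lemma divisor_cap_ge1 : 1 <= D%:R :> R.
Proof. by rewrite ler1n; apply: (@tauD 1); rewrite /= ltnW. Qed.

Lemma scale_gt0 M : 0 < G M.
Proof.
have a_gt0 : 0 < a := lt_le_trans ltr01 a_ge1.
by rewrite /G ltr_wpDr ?ltr_wpDl ?mulr_ge0 ?exprn_ge0 ?exprn_gt0 // ltW.
Qed.

(** For L <= q / (8 M1) with M1 >= a s one has (L a)^2 <= q, so that the three
    terms of a^8 G(L^2) are bounded by those of the expanded square
    (a^5 s + a^8)^2. *)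
Lemma energy_short (phi t : R) (M1 L : nat) : 0 <= t -> t ^+ 2 = phi ->
    (forall M, (0 < M <= q)%N -> E M <= phi * (M%:R * G M)) ->
    a * s <= M1%:R -> (8 * (M1 * L) <= q)%N ->
  E L <= D%:R * t * L%:R * (a ^+ 5 * s + a ^+ 8).
Proof.
move=> t_ge0 tE E_le asM ML; have D_ge1 := divisor_cap_ge1.
have [->|L_gt0] := posnP L.
  by rewrite /energy big_geq // mulr0 mul0r.
have a_gt0 : 0 < a := lt_le_trans ltr01 a_ge1.
have s_gt0 : 0 < s.
  rewrite lt_neqAle s_ge0 andbT; apply/eqP => s0; move: sE.
  by rewrite -s0 expr0n => /esym/eqP; rewrite pnatr_eq0; case: (q) q1.
have L_le : L%:R * a <= s.
  have h : 8 * (M1%:R * L%:R) <= s ^+ 2 by rewrite sE -!natrM ler_nat.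
  have h2 : a * s * L%:R <= M1%:R * L%:R by rewrite ler_wpM2r.
  have h3 : 0 <= M1%:R * L%:R :> R by rewrite mulr_ge0.
  by rewrite -(ler_pM2r s_gt0); nra.
have L2 : (L%:R * a) ^+ 2 <= q%:R by rewrite -sE lerXn2r ?nnegrE ?mulr_ge0 // ltW.
have LLq : (L * L <= q)%N.
  rewrite -(ler_nat R) natrM; apply: le_trans L2; rewrite exprMn expr2.
  by rewrite ler_peMr ?mulr_ge0 // exprn_ege1.
have LL0 : (0 < L * L)%N by rewrite muln_gt0 L_gt0.
have Lr0 : (0 : R) < L%:R by rewrite ltr0n.
have hold : E L ^+ 2 <= (size A)%:R ^+ 2 * D%:R ^+ 2 * E (L * L).
  apply: energy_holder => // k /andP[k0 kL]; apply: tauD.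
  by rewrite k0 (leq_trans kL).
have EE : E (L * L) <= phi * ((L * L)%:R * G (L * L)) by apply: E_le; rewrite LL0.
have GE : (a ^+ 4) ^+ 2 * G (L * L) <= (a ^+ 5 * s + a ^+ 8) ^+ 2.
  apply: (@le_trans _ _
      ((a ^+ 4) ^+ 2 * (a ^+ 2 * s ^+ 2 + a ^+ 8 + a ^+ 5 * s))).
    rewrite ler_wpM2l ?sqr_ge0 // /G !lerD2r natrM sE.
    have -> : a ^+ 4 * (L%:R * L%:R) = a ^+ 2 * (L%:R * a) ^+ 2 by ring.
    by rewrite ler_wpM2l ?sqr_ge0.
  rewrite -subr_ge0.
  have -> : (a ^+ 5 * s + a ^+ 8) ^+ 2 -
    (a ^+ 4) ^+ 2 * (a ^+ 2 * s ^+ 2 + a ^+ 8 + a ^+ 5 * s) = a ^+ 13 * s by ring.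
  by rewrite mulr_ge0 ?exprn_ge0 // ltW.
have b_ge0 : 0 <= a ^+ 5 * s + a ^+ 8.
  by rewrite addr_ge0 ?mulr_ge0 ?exprn_ge0 // ltW.
rewrite -(@ler_pXn2r _ 2) ?nnegrE ?energy_ge0 ?mulr_ge0 //.
apply: le_trans hold _.
apply: (@le_trans _ _
    ((size A)%:R ^+ 2 * D%:R ^+ 2 * (phi * ((L * L)%:R * G (L * L))))).
  by rewrite ler_wpM2l // mulr_ge0 ?sqr_ge0.
rewrite -aE -tE natrM.
have -> : (a ^+ 4) ^+ 2 * D%:R ^+ 2 * (t ^+ 2 * (L%:R * L%:R * G (L * L))) =
  (D%:R * t * L%:R) ^+ 2 * ((a ^+ 4) ^+ 2 * G (L * L)) by ring.
by rewrite [leRHS]exprMn ler_wpM2l ?sqr_ge0.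
Qed.

(** Reflection to L = q / (8 M1), then [energy_short].  If M1 = q then L = 0 and
    the dual sum is empty. *)
Lemma energy_long (phi t : R) (M1 : nat) : 0 <= t -> t ^+ 2 = phi ->
    (forall M, (0 < M <= q)%N -> E M <= phi * (M%:R * G M)) ->
    (0 < M1 <= q)%N -> M1 = q \/ a * s <= M1%:R ->
  E M1 <= 16 * M1%:R *
    (64 * a ^+ 4 * M1%:R + 32 * D%:R * t * (a ^+ 5 * s + a ^+ 8)).
Proof.
move=> t_ge0 tE E_le /andP[M0 Mq] M1P; have D_ge1 := divisor_cap_ge1.
have a_gt0 : 0 < a := lt_le_trans ltr01 a_ge1.
pose L := (q %/ (8 * M1))%N.
have ML : (8 * (M1 * L) <= q)%N by rewrite mulnA mulnC leq_trunc_div.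
have Lq : (L < q)%N by rewrite ltn_Pdiv ?(ltnW q1) // (@leq_trans 8) // leq_pmulr.
have qL : (q <= 8 * M1 * L.+1)%N by rewrite mulnC ltnW // ltn_ceil // muln_gt0.
have b_ge0 : 0 <= a ^+ 5 * s + a ^+ 8.
  by rewrite addr_ge0 ?mulr_ge0 ?exprn_ge0 // ltW.
have EL : E L <= D%:R * t * L%:R * (a ^+ 5 * s + a ^+ 8).
  case: M1P => [M1q|asM]; last exact: (energy_short t_ge0 tE E_le asM ML).
  have -> : L = 0%N by rewrite /L divn_small // M1q ltn_Pmull // ltnW.
  by rewrite /energy big_geq // mulr0 mul0r.
apply: le_trans (energy_reflect q_pr AP uniqA Mq Lq ML) _.
rewrite -[leRHS]mulrA ler_pM2l //; rewrite mulrDr -aE.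
have qR : (0 : R) < q%:R by rewrite ltr0n ltnW.
have HR : (0 : R) < L.+1%:R by rewrite ltr0n.
have M1R : (0 : R) < M1%:R by rewrite ltr0n.
have qH : q%:R / L.+1%:R <= 8 * M1%:R :> R.
  by rewrite ler_pdivrMr // -!natrM ler_nat.
set h := q%:R / L.+1%:R in qH.
have h0 : 0 <= h by rewrite divr_ge0 // ltW.
have -> : a ^+ 4 * q%:R ^+ 2 / L.+1%:R ^+ 2 = a ^+ 4 * h ^+ 2.
  by rewrite /h; field; rewrite gt_eqF.
have -> : 4 * q%:R / L.+1%:R ^+ 2 = 4 * h ^+ 2 / q%:R.
  by rewrite /h; field; rewrite !gt_eqF.
have h2 : h ^+ 2 <= 64 * M1%:R ^+ 2.
  have -> : 64 * M1%:R ^+ 2 = (8 * M1%:R) ^+ 2 :> R by ring.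
  by rewrite lerXn2r // nnegrE mulr_ge0.
apply: lerD.
  have -> : M1%:R * (64 * a ^+ 4 * M1%:R) = a ^+ 4 * (64 * M1%:R ^+ 2) by ring.
  by rewrite ler_wpM2l ?exprn_ge0 // ltW.
apply: (@le_trans _ _ (4 * (64 * M1%:R ^+ 2) / q%:R *
    (D%:R * t * L%:R * (a ^+ 5 * s + a ^+ 8)))).
  apply: ler_pM; rewrite ?energy_ge0 ?divr_ge0 ?mulr_ge0 ?sqr_ge0 //.
  by rewrite ler_pM2r ?invr_gt0 // ler_pM2l.
have -> : 4 * (64 * M1%:R ^+ 2) / q%:R * (D%:R * t * L%:R * (a ^+ 5 * s + a ^+ 8))
  = M1%:R * (32 * D%:R * t * (a ^+ 5 * s + a ^+ 8)) *
    ((8 * (M1%:R * L%:R)) / q%:R).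
  by field; rewrite gt_eqF.
rewrite ler_piMr //; first by rewrite !mulr_ge0 // ltW.
by rewrite ler_pdivrMr // mul1r -!natrM ler_nat.
Qed.

(** The threshold a s = q^(1/2) A^(1/4) balances the term A M1 of the
    reflection against the term A^(3/2) q / M1 that reflection and squaring
    produce; both then equal A^(5/4) q^(1/2). *)
Lemma energy_step (phi t : R) (M : nat) : 0 <= t -> t ^+ 2 = phi ->
    (forall M, (0 < M <= q)%N -> E M <= phi * (M%:R * G M)) ->
    (0 < M <= q)%N ->
  E M <= 2048 * D%:R ^+ 2 * (1 + t) * (M%:R * G M).
Proof.
move=> t_ge0 tE E_le /andP[M0 Mq]; have D_ge1 := divisor_cap_ge1.
have a_gt0 : 0 < a := lt_le_trans ltr01 a_ge1.
have as_ge0 : 0 <= a * s by rewrite mulr_ge0 // ltW.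
pose M' := (Num.truncn (a * s)).+1.
have asM' : a * s <= M'%:R by apply: ltW; exact: truncnS_gt.
have M'as : M'%:R <= a * s + 1 by rewrite -natr1 lerD2r truncn_le.
have [M1 [P [M1P M1le' Pq PM M1_le]]] := @intermediate_length q M M' q1
  (introT andP (conj M0 Mq)) isT.
have M1q : (0 < M1 <= q)%N by case: M1P => -[].
have M1_gt0 : (0 < M1)%N by case/andP: M1q.
have M1_alt : M1 = q \/ a * s <= M1%:R.
  case: M1P => -[_ h]; [by left|right].
  by apply: le_trans asM' _; rewrite ler_nat.
have long := energy_long t_ge0 tE E_le M1q M1_alt.
have dil : P%:R * E M <= D%:R * E M1.
  apply: energy_dilate => // k /andP[k0 kM]; apply: tauD.
  by rewrite k0 (leq_trans kM) //; case/andP: M1q.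
have M1le : M1%:R <= M%:R + (a * s + 1).
  apply: le_trans (_ : _ <= M%:R + M'%:R) _; last by rewrite lerD2l.
  by rewrite -natrD ler_nat.
have M1R : (0 : R) < M1%:R by rewrite ltr0n.
have MR : (0 : R) < M%:R by rewrite ltr0n.
have b_ge0 : 0 <= a ^+ 5 * s + a ^+ 8.
  by rewrite addr_ge0 ?mulr_ge0 ?exprn_ge0 // ltW.
have G1 : a ^+ 4 * M1%:R <= G M.
  apply: (@le_trans _ _ (a ^+ 4 * (M%:R + (a * s + 1)))).
    by rewrite ler_wpM2l ?exprn_ge0 // ltW.
  have -> : a ^+ 4 * (M%:R + (a * s + 1)) =
      a ^+ 4 * M%:R + a ^+ 4 + a ^+ 5 * s by ring.
  by rewrite /G lerD2r lerD2l ler_weXn2l.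
have G2 : a ^+ 5 * s + a ^+ 8 <= G M.
  by rewrite /G addrC -[X in _ <= X]addrA lerDr mulr_ge0 ?exprn_ge0 // ltW.
have big : E M1 <= 16 * M1%:R * ((64 + 32 * D%:R * t) * G M).
  apply: le_trans long _; rewrite ler_wpM2l ?mulr_ge0 // [leRHS]mulrDl lerD //.
    by rewrite -mulrA ler_wpM2l.
  by rewrite ler_wpM2l // !mulr_ge0.
rewrite -(ler_pM2l M1R).
have st : M1%:R * E M <= 2 * M%:R * (D%:R * E M1).
  apply: (@le_trans _ _ ((2 * (M * P))%:R * E M)).
    by rewrite ler_wpM2r ?energy_ge0 // ler_nat.
  by rewrite !natrM -!mulrA ler_wpM2l // ler_wpM2l.
apply: le_trans st _.
apply: (@le_trans _ _
    (2 * M%:R * (D%:R * (16 * M1%:R * ((64 + 32 * D%:R * t) * G M))))).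
  by rewrite ler_wpM2l ?mulr_ge0 // ler_wpM2l.
have -> : 2 * M%:R * (D%:R * (16 * M1%:R * ((64 + 32 * D%:R * t) * G M))) =
  M1%:R * (M%:R * G M) * (2048 * D%:R + 1024 * D%:R ^+ 2 * t) by ring.
have -> : M1%:R * (2048 * D%:R ^+ 2 * (1 + t) * (M%:R * G M)) =
  M1%:R * (M%:R * G M) * (2048 * D%:R ^+ 2 * (1 + t)) by ring.
rewrite ler_wpM2l ?mulr_ge0 ?(ltW (scale_gt0 _)) //.
have DD : D%:R <= D%:R ^+ 2 :> R by rewrite expr2 ler_peMr.
have Dt : 0 <= D%:R ^+ 2 * t by rewrite mulr_ge0 ?sqr_ge0.
by nra.
Qed.

(** Apply [energy_step] at the length where the best constant is attained. *)
Lemma energy_bound N : (0 < N <= q)%N ->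
  E N <= (2 ^+ 12 * D%:R ^+ 2) ^+ 2 * (N%:R * G N).
Proof.
move=> Nq; have D_ge1 := divisor_cap_ge1.
pose F (i : 'I_q) := E i.+1 / (i.+1%:R * G i.+1).
have den_gt0 M : (0 < M)%N -> 0 < M%:R * G M.
  by move=> M0; rewrite mulr_gt0 ?ltr0n ?scale_gt0.
pose i0 := Ordinal (ltnW q1).
have [i _ iP] := @arg_maxP _ R 'I_q i0 xpredT F isT.
pose phi := F i; have phi_ge0 : 0 <= phi.
  by rewrite divr_ge0 ?energy_ge0 // ltW // den_gt0.
have E_le M : (0 < M <= q)%N -> E M <= phi * (M%:R * G M).
  case: M => [//|M] /= Mq; rewrite -ler_pdivrMr ?den_gt0 //.
  exact: (iP (Ordinal Mq)).
apply: le_trans (E_le _ Nq) _; rewrite ler_wpM2r ?(ltW (den_gt0 _ _)) //.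
  by case/andP: Nq.
pose t := Num.sqrt phi; have tE : t ^+ 2 = phi by rewrite sqr_sqrtr.
have t0 : 0 <= t by exact: sqrtr_ge0.
have iq : (0 < i.+1 <= q)%N by rewrite /= ltn_ord.
have := energy_step t0 tE E_le iq.
rewrite -ler_pdivrMr ?den_gt0 // -/(F i) -/phi => phi_le.
have -> : (2 ^+ 12 * D%:R ^+ 2) ^+ 2 = (2 * (2048 * D%:R ^+ 2)) ^+ 2 :> R by ring.
rewrite -[leLHS]tE; apply: quadratic_bootstrap => //; last by rewrite tE.
have D2 : 1 <= D%:R ^+ 2 :> R by rewrite exprn_ege1.
by move: (D%:R ^+ 2) D2 => d d1; lra.
Qed.

End Bootstrap.

(** * The loss factor *)

Definition max_num_divisors (q : nat) : nat :=
  \max_(1 <= k < q.+1) num_divisors k.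

Lemma num_divisors_le_max q k : (0 < k <= q)%N ->
  (num_divisors k <= max_num_divisors q)%N.
Proof. by move=> kq; apply: leq_bigmax_seq; rewrite ?mem_index_iota. Qed.

Lemma max_num_divisors_gt0 q : (0 < q)%N -> (0 < max_num_divisors q)%N.
Proof.
move=> q0; apply: (@leq_trans (num_divisors 1)) => //.
by rewrite num_divisors_le_max.
Qed.

Lemma max_num_divisors_bound k q : (0 < k)%N ->
  (max_num_divisors q ^ k <= (k ^ k) ^ (2 ^ k) * q)%N.
Proof.
move=> k0; rewrite /max_num_divisors big_seq.
elim/big_ind: _ => [|x y xb yb|i]; first by rewrite exp0n.
  by rewrite /maxn; case: ifP.
rewrite mem_index_iota => /andP[i0 iq].
apply: leq_trans (num_divisors_bound k0 i0) _.
by rewrite leq_mul2l -ltnS iq orbT.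
Qed.

(** The exponent for which q^o(q) is the constant of [energy_bound] before
    squaring. *)
Definition loss_exponent (R : realType) (q : nat) : R :=
  ln (2 ^+ 12 * (max_num_divisors q)%:R ^+ 2) / ln q%:R.

Lemma loss_exponentE (R : realType) q : (1 < q)%N ->
  q%:R `^ loss_exponent R q = 2 ^+ 12 * (max_num_divisors q)%:R ^+ 2.
Proof.
move=> q1; have q0 : q%:R != 0 :> R by rewrite pnatr_eq0; lia.
have lnq : ln q%:R != 0 :> R by rewrite gt_eqF // ln_gt0 // ltr1n.
rewrite /powR (negPf q0) /loss_exponent mulfVK // lnK // posrE.
by rewrite mulr_gt0 ?exprn_gt0 // ltr0n max_num_divisors_gt0 // ltnW.
Qed.

(** By [max_num_divisors_bound] the logarithm of the largest number of
    divisors is at most (ln q + O_k(1)) / k for every k. *)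
Lemma cvg_loss_exponent (R : realType) :
  loss_exponent R q @[q --> \oo] --> (0 : R).
Proof.
apply/cvgrPdist_lt => eps eps0.
pose k := (Num.truncn (4 / eps)).+1.
have k_ge : 4 / eps < k%:R by exact: truncnS_gt.
have kR : (0 : R) < k%:R by rewrite ltr0n.
pose C := ((k ^ k) ^ (2 ^ k))%N.
have C0 : (0 < C)%N by rewrite !expn_gt0.
have CR : (0 : R) < C%:R by rewrite ltr0n.
pose c : R := ln (2 ^+ 12) + 2 / k%:R * ln C%:R.
near=> q.
have q2 : (2 : R) <= q%:R by near: q; exact: nbhs_infty_ger.
have qX : expR (2 / eps * (c + 1)) <= q%:R by near: q; exact: nbhs_infty_ger.
have q1 : (1 < q)%N by rewrite -(ler_nat R).
have q0 : (0 : R) < q%:R by lra.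
have lnq : 0 < ln q%:R :> R by rewrite ln_gt0 // ltr1n.
have T0 : (0 < max_num_divisors q)%N by rewrite max_num_divisors_gt0 // ltnW.
have TR : (1 : R) <= (max_num_divisors q)%:R by rewrite ler1n.
have lnT : ln (max_num_divisors q)%:R <= (ln C%:R + ln q%:R) / k%:R :> R.
  rewrite ler_pdivlMr // mulr_natr -lnXn ?ltr0n // -lnM ?posrE // ler_ln ?posrE.
  - by rewrite -natrX -natrM ler_nat max_num_divisors_bound.
  - by rewrite exprn_gt0 // ltr0n.
  - by rewrite mulr_gt0.
have lnE : ln (2 ^+ 12 * (max_num_divisors q)%:R ^+ 2) =
    ln (2 ^+ 12) + 2 * ln (max_num_divisors q)%:R :> R.
  by rewrite lnM ?posrE ?exprn_gt0 ?ltr0n // (lnXn 2) ?ltr0n // mulr_natl.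
have lnq_big : 2 / eps * (c + 1) <= ln q%:R.
  by rewrite -[leLHS]expRK ler_ln ?posrE ?expR_gt0.
have ln_ge0' : 0 <= ln (2 ^+ 12 * (max_num_divisors q)%:R ^+ 2) :> R.
  apply: ln_ge0; have := sqr_ge0 ((max_num_divisors q)%:R - 1 : R); nra.
rewrite sub0r normrN /loss_exponent ger0_norm ?divr_ge0 ?(ltW lnq) //.
rewrite ltr_pdivrMr // lnE.
have k_inv : 2 / k%:R < eps / 2.
  by rewrite ltr_pdivrMr //; move: k_ge; rewrite ltr_pdivrMr //; lra.
have cq : c + 1 <= eps / 2 * ln q%:R.
  have -> : c + 1 = eps / 2 * (2 / eps * (c + 1)) by field; rewrite gt_eqF.
  by rewrite ler_pM2l // divr_gt0.
have : ln (2 ^+ 12) + 2 * ln (max_num_divisors q)%:R <= c + 2 / k%:R * ln q%:R.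
  rewrite /c -addrA lerD2l -mulrDr -mulrA ler_pM2l //.
  by rewrite mulrC in lnT.
have : 2 / k%:R * ln q%:R <= eps / 2 * ln q%:R by rewrite ler_pM2r // ltW.
by lra.
Unshelve. all: end_near.
Qed.

(** * From the energy to the mean value *)

Section LargeValues.
Variables (R : realType) (q : nat).
Local Notation char := {ffun 'Z_q -> R[i]}.

(** For each phi in A the characters chi phi are distinct elements of B, and
    chi = (chi phi) conj(phi); averaging over phi introduces the double sum of
    [duality], to which Cauchy-Schwarz applies. *)
Lemma large_values (A B : seq char) (N : nat) (alpha : nat -> R[i]) :
    {in A, forall chi, dirichlet_character chi} -> uniq A ->
    {in A &, forall chi phi, charM chi phi \in B} ->
    (forall n : nat, (1 <= n <= N)%N -> cabs (alpha n) <= 1) ->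
  ((size A)%:R *
     \sum_(chi <- A) cabs (\sum_(1 <= n < N.+1) alpha n * chi n%:R) ^+ 2) ^+ 2 <=
  energy A N * energy B N.
Proof.
move=> AP uniqA AAB alpha1.
set r := index_iota 1 N.+1.
pose f (psi phi : char) :=
  cabs (\sum_(n <- r) alpha n * (psi n%:R * conjc (phi n%:R))) ^+ 2.
have f_ge0 psi phi : 0 <= f psi phi by exact: sqr_ge0.
pose Y := \sum_(psi <- B) \sum_(phi <- A) f psi phi.
have XY : (size A)%:R *
    \sum_(chi <- A) cabs (\sum_(n <- r) alpha n * chi n%:R) ^+ 2 <= Y.
  rewrite /Y exchange_big mulr_natl -[leLHS]iter_addr_0 -count_predT.
  rewrite -big_const_seq.
  rewrite big_seq [leRHS]big_seq; apply: ler_sum => phi phiA.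
  have phiP := AP _ phiA; rewrite -[leRHS]mul1r.
  rewrite (eq_big_seq (fun chi => f (charM chi phi) phi)); last first.
    move=> chi chiA; congr (cabs _ ^+ 2); apply: eq_bigr => n _.
    by rewrite char_mulK //; exact: AP.
  apply: (sum_pushforward_le (D := 1) (phi := fun chi => charM chi phi)
    (g := fun psi => f psi phi)) => //.
    by apply/allP => chi chiA; exact: AAB.
  move=> k _; apply: (@leq_trans (count_mem k [seq charM chi phi | chi <- A])).
    by rewrite count_map.
  rewrite count_uniq_mem ?leq_b1 // map_inj_in_uniq // => chi chi' chiA chiA' E.
  apply/ffunP => x; rewrite -(char_mulK x (AP _ chiA) phiP) E char_mulK //.
  exact: AP.
have Y_le : Y <= \sum_(mn <- [seq (m, n) | m <- r, n <- r])
    cabs (correlation B mn.1%:R mn.2%:R) * cabs (correlation A mn.1%:R mn.2%:R).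
  have Y_ge0 : 0 <= Y by apply: sumr_ge0 => psi _; apply: sumr_ge0.
  rewrite -(cabs_real Y_ge0) (duality r alpha (fun n => n%:R) A B).
  rewrite big_allpairs_dep /=; apply: le_trans (ler_cabs_sum _ _) _.
  rewrite big_seq [leRHS]big_seq; apply: ler_sum => m.
  rewrite mem_index_iota => mN.
  apply: le_trans (ler_cabs_sum _ _) _.
  rewrite big_seq [leRHS]big_seq; apply: ler_sum => n.
  rewrite mem_index_iota => nN.
  rewrite !cabsM !cabs_conj ler_piMl ?mulr_ge0 ?cabs_ge0 //.
  by rewrite mulr_ile1 ?cabs_ge0 ?alpha1.
have S_ge0 : 0 <= (size A)%:R *
    \sum_(chi <- A) cabs (\sum_(n <- r) alpha n * chi n%:R) ^+ 2.
  by rewrite mulr_ge0 ?sumr_ge0 // => chi _; exact: sqr_ge0.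
apply: (@le_trans _ _ (Y ^+ 2)).
  by rewrite lerXn2r ?nnegrE //; exact: le_trans XY.
apply: (@le_trans _ _ ((\sum_(mn <- [seq (m, n) | m <- r, n <- r])
    cabs (correlation B mn.1%:R mn.2%:R) *
    cabs (correlation A mn.1%:R mn.2%:R)) ^+ 2)).
  by rewrite lerXn2r ?nnegrE ?(le_trans (le_trans S_ge0 XY)) //;
     apply: le_trans XY.
apply: le_trans (cauchy_schwarz _ _ _) _.
by rewrite mulrC !big_allpairs_dep.
Qed.

End LargeValues.

Lemma powR_exprn (R : realType) (c x : R) n : (c `^ x) ^+ n = c `^ (x * n%:R).
Proof. by rewrite -powR_mulrn ?powR_ge0 // -powRrM. Qed.

Lemma energy_scale_dilate (R : realType) (a b kap s : R) N :
  1 <= kap -> 0 <= a -> 0 <= b -> b <= kap * a -> 0 <= s ->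
  energy_scale b s N <= kap ^+ 8 * energy_scale a s N.
Proof.
move=> k1 a0 b0 ba s0; have k0 : 0 <= kap by exact: le_trans k1.
have step m : (m <= 8)%N -> b ^+ m <= kap ^+ 8 * a ^+ m.
  move=> m8; apply: (@le_trans _ _ ((kap * a) ^+ m)).
    by rewrite lerXn2r ?nnegrE ?mulr_ge0.
  by rewrite exprMn ler_wpM2r ?exprn_ge0 // ler_weXn2l.
have -> : kap ^+ 8 * energy_scale a s N =
    kap ^+ 8 * a ^+ 4 * N%:R + kap ^+ 8 * a ^+ 8 + kap ^+ 8 * a ^+ 5 * s.
  by rewrite /energy_scale; ring.
apply: lerD; first apply: lerD.
- by rewrite (ler_wpM2r (ler0n _ _)) // step.
- exact: step.
- by rewrite (ler_wpM2r s0) // step.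
Qed.

Section Final.
Variables (R : realType) (q : nat).
Hypothesis q_pr : prime q.
Variables (A : {fset {ffun 'Z_q -> R[i]}}) (K : R) (N : nat).
Variable alpha : nat -> R[i].
Hypothesis AP : forall chi, chi \in A -> dirichlet_character chi.
Hypothesis K1 : 1 <= K.
Hypothesis AK : (#|` product_set A|)%:R <= K * (#|` A|)%:R.
Hypothesis Nq : (0 < N <= q)%N.
Hypothesis alpha1 : forall n : nat, (1 <= n <= N)%N -> cabs (alpha n) <= 1.
Let loss : R := 2 ^+ 12 * (max_num_divisors q)%:R ^+ 2.

Lemma product_set_dirichlet psi :
  psi \in product_set A -> dirichlet_character psi.
Proof.
move=> /imfset2P[chi1 /= h1 [chi2 /= h2 ->]].
by apply: charM_dirichlet; exact: AP.
Qed.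

(** As #(A.A) <= K #A, the scale of the energy of A.A is at most K^2 times that
    of A; the geometric mean loses K. *)
Lemma sum_squares_bound : (0 < #|` A|)%N ->
  (#|` A|)%:R *
    \sum_(chi <- A) cabs (\sum_(1 <= n < N.+1) alpha n * chi n%:R) ^+ 2 <=
  loss ^+ 2 * K *
    (N%:R * energy_scale ((#|` A|)%:R `^ (1 / 4)) (q%:R `^ (1 / 2)) N).
Proof.
move=> A0; set c : R := (#|` A|)%:R; set b : R := (#|` product_set A|)%:R.
have bK : b <= K * c by exact: AK.
set a := c `^ (1 / 4); set s := q%:R `^ (1 / 2).
have fourth (x : R) : 0 <= x -> (x `^ (1 / 4)) ^+ 4 = x.
  by move=> x0; rewrite powR_exprn (_ : 1 / 4 * 4 = 1) ?powRr1 //; field.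
have root_ge1 (x : R) : 1 <= x -> 1 <= x `^ (1 / 4).
  move=> x1; apply: (@le_trans _ _ (1 `^ (1 / 4))); first by rewrite powR1 lexx.
  by rewrite ge0_ler_powR ?nnegrE //; lra.
have c1 : 1 <= c by rewrite ler1n.
have b1 : 1 <= b.
  rewrite ler1n cardfs_gt0; apply/fset0Pn.
  have /fset0Pn[chi chiA] : A != fset0 by rewrite -cardfs_gt0.
  by exists (charM chi chi); apply: in_imfset2.
have sE : s ^+ 2 = q%:R.
  by rewrite powR_exprn (_ : 1 / 2 * 2 = 1) ?powRr1 //; field.
have s0 : 0 <= s by exact: powR_ge0.
have tauD k : (0 < k <= q)%N -> (num_divisors k <= max_num_divisors q)%N.
  exact: num_divisors_le_max.
have EA : energy A N <= loss ^+ 2 * (N%:R * energy_scale a s N).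
  have aE : a ^+ 4 = c by rewrite fourth // ler0n.
  exact: (energy_bound q_pr AP (fset_uniq A) tauD (root_ge1 _ c1) aE s0 sE Nq).
have EB : energy (product_set A) N <=
    loss ^+ 2 * (N%:R * energy_scale (b `^ (1 / 4)) s N).
  have bE : (b `^ (1 / 4)) ^+ 4 = b by rewrite fourth // ler0n.
  exact: (energy_bound q_pr product_set_dirichlet (fset_uniq _) tauD
    (root_ge1 _ b1) bE s0 sE Nq).
have K0 : 0 <= K := le_trans ler01 K1.
have GB : energy_scale (b `^ (1 / 4)) s N <= K ^+ 2 * energy_scale a s N.
  have -> : K ^+ 2 = (K `^ (1 / 4)) ^+ 8.
    by rewrite (exprM _ 4 2) fourth.
  apply: energy_scale_dilate; rewrite ?powR_ge0 ?root_ge1 //.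
  rewrite /a -powRM ?ler0n //.
  by rewrite ge0_ler_powR ?nnegrE ?ler0n ?mulr_ge0 ?ler0n //; lra.
have G_ge0 : 0 <= energy_scale a s N.
  by rewrite /energy_scale !addr_ge0 ?mulr_ge0 ?exprn_ge0 ?powR_ge0 ?ler0n.
have LV := large_values (A := A) (B := product_set A) AP (fset_uniq A) _ alpha1.
rewrite -(@ler_pXn2r _ 2) ?nnegrE //; first last.
- by rewrite !mulr_ge0 ?sqr_ge0 ?ler0n.
- by rewrite mulr_ge0 ?ler0n ?sumr_ge0 // => chi _; exact: sqr_ge0.
apply: le_trans (LV _) _.
  by move=> chi phi chiA phiA; exact: in_imfset2.
apply: (@le_trans _ _ (loss ^+ 2 * (N%:R * energy_scale a s N) *
   (loss ^+ 2 * (N%:R * (K ^+ 2 * energy_scale a s N))))).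
  apply: ler_pM; rewrite ?energy_ge0 //; apply: le_trans EB _.
  by rewrite ler_wpM2l ?sqr_ge0 // ler_wpM2l ?ler0n.
by rewrite le_eqVlt; apply/orP; left; apply/eqP; ring.
Qed.

(** Cauchy-Schwarz over A.  In terms of u = A^(1/8), v = q^(1/4), n = N^(1/2),
    the energy bound becomes a sum of three squares, at most the square of the
    sum. *)
Lemma mean_value_bound : mean_value alpha A N <=
  K `^ (1 / 2) * (N%:R `^ (1 / 2) + (#|` A|)%:R `^ (- (1 / 2)) * N%:R +
    (#|` A|)%:R `^ (- (3 / 8)) * N%:R `^ (1 / 2) * q%:R `^ (1 / 4)) * loss.
Proof.
have loss_ge0 : 0 <= loss by rewrite mulr_ge0 ?exprn_ge0 ?ler0n.
set rhs := (X in _ <= X).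
have rhs_ge0 : 0 <= rhs.
  by rewrite /rhs !mulr_ge0 ?addr_ge0 ?mulr_ge0 ?powR_ge0 ?ler0n.
have [/eqP A0|A0] := posnP #|` A|.
  by rewrite /mean_value (eqP A0) invr0 mul0r.
have := sum_squares_bound A0; rewrite /rhs /mean_value in rhs_ge0 *.
set c : R := (#|` A|)%:R in rhs_ge0 *.
have c_gt0 : 0 < c by rewrite ltr0n.
set k := K `^ (1 / 2) in rhs_ge0 *; set n := N%:R `^ (1 / 2) in rhs_ge0 *.
set v := q%:R `^ (1 / 4) in rhs_ge0 *; pose u := c `^ (1 / 8).
have u_gt0 : 0 < u by exact: powR_gt0.
have -> : K = k ^+ 2.
  rewrite powR_exprn (_ : 1 / 2 * 2 = 1); last by field.
  by rewrite powRr1 // (le_trans ler01).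
have NE : N%:R = n ^+ 2.
  by rewrite powR_exprn (_ : 1 / 2 * 2 = 1) ?powRr1 ?ler0n //; field.
have -> : q%:R `^ (1 / 2) = v ^+ 2 by rewrite powR_exprn; congr (_ `^ _); field.
have -> : c `^ (1 / 4) = u ^+ 2 by rewrite powR_exprn; congr (_ `^ _); field.
have c2 : c `^ (- (1 / 2)) = (u ^+ 4)^-1.
  by rewrite powRN powR_exprn; congr (_ `^ _)^-1; field.
have c3 : c `^ (- (3 / 8)) = (u ^+ 3)^-1.
  by rewrite powRN powR_exprn; congr (_ `^ _)^-1; field.
have cE : c = u ^+ 8.
  by rewrite powR_exprn (_ : 1 / 8 * 8 = 1) ?powRr1 ?ltW //; field.
rewrite c2 c3 in rhs_ge0 *.
set S := \sum_(chi <- A) cabs _ ^+ 2 => S_le.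
have := sqr_sum_le A (fun chi => cabs (\sum_(1 <= n < N.+1) alpha n * chi n%:R)).
rewrite -/S -/c; set T := \sum_(chi <- A) cabs _ => TS.
rewrite -(@ler_pXn2r _ 2) ?nnegrE //; last first.
  apply: mulr_ge0; first by rewrite invr_ge0 ltW.
  by apply: sumr_ge0 => chi _; exact: cabs_ge0.
apply: (@le_trans _ _ (c^-1 ^+ 2 * (c * S))).
  by rewrite exprMn ler_wpM2l ?sqr_ge0.
apply: (@le_trans _ _ (c^-1 ^+ 2 * (loss ^+ 2 * k ^+ 2 *
    (N%:R * energy_scale (u ^+ 2) (v ^+ 2) N)))).
  by rewrite ler_wpM2l ?sqr_ge0.
rewrite /energy_scale cE NE.
have -> : (u ^+ 8)^-1 ^+ 2 * (loss ^+ 2 * k ^+ 2 * (n ^+ 2 *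
    ((u ^+ 2) ^+ 4 * n ^+ 2 + (u ^+ 2) ^+ 8 + (u ^+ 2) ^+ 5 * v ^+ 2))) =
  (k * loss) ^+ 2 * (((u ^+ 4)^-1 * n ^+ 2) ^+ 2 + n ^+ 2 +
    ((u ^+ 3)^-1 * n * v) ^+ 2).
  by field; rewrite gt_eqF.
set X := (u ^+ 4)^-1 * n ^+ 2; set Z := (u ^+ 3)^-1 * n * v.
have X0 : 0 <= X by rewrite mulr_ge0 ?invr_ge0 ?exprn_ge0 ?powR_ge0 // ltW.
have Z0 : 0 <= Z by rewrite !mulr_ge0 ?invr_ge0 ?exprn_ge0 ?powR_ge0 // ltW.
have n0 : 0 <= n by exact: powR_ge0.
have -> : k * (n + X + Z) * loss = (k * loss) * (n + X + Z) by ring.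
rewrite [leRHS]exprMn ler_wpM2l ?sqr_ge0 //.
have := mulr_ge0 X0 Z0; have := mulr_ge0 X0 n0; have := mulr_ge0 Z0 n0.
by move=> *; nra.
Qed.

End Final.

Theorem theorem2p7 (R : realType) :
  exists2 o : nat -> R, o q @[q --> \oo] --> (0 : R) &
    \forall q \near \oo, prime q ->
      forall (A : {fset {ffun 'Z_q -> R[i]}}) (K : R) (N : nat)
             (alpha : nat -> R[i]),
        (forall chi, chi \in A -> dirichlet_character chi) ->
        1 <= K ->
        (#|` product_set A|)%:R <= K * (#|` A|)%:R ->
        (0 < N <= q)%N ->
        (forall n : nat, (1 <= n <= N)%N -> cabs (alpha n) <= 1) ->
        mean_value alpha A N <=
          K `^ (1 / 2) *
          (N%:R `^ (1 / 2) +
           (#|` A|)%:R `^ (- (1 / 2)) * N%:R +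
           (#|` A|)%:R `^ (- (3 / 8)) * N%:R `^ (1 / 2) * q%:R `^ (1 / 4)) *
          q%:R `^ (o q).
Proof.
exists (loss_exponent R); first exact: cvg_loss_exponent.
near=> q; move=> q_pr A K N alpha AP K1 AK Nq alpha1.
by rewrite loss_exponentE ?prime_gt1 //; exact: mean_value_bound.
Unshelve. all: end_near.
Qed.
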